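(* Let $\mu$ be a positive real with $\sqrt{\mu}<\frac{1}{400}$. Let $G$ be an $n$-vertex graph of minimum degree at least $\frac{n}{2}$ and let $\mathcal{F}$ be a $\mu n$-bounded incompatibility system over $G$. Then at least one of the following holds: (i) there exists a Hamilton cycle in $G$ compatible with $\mathcal{F}$; (ii) there exist two sets $A,B\subseteq V(G)$ with $|A|,|B|\ge(\frac12-200\sqrt{\mu})n$ such that $e(A,B)\le 16\sqrt{\mu}\,n^2$.
   Context: All graphs are finite and simple. For sets of vertices $X,Y$, $e(X,Y)$ is the number of edges with one endpoint in $X$ and the other in $Y$, counted with multiplicity (so $e(X,X)$ is twice the number of edges inside $X$). An incompatibility system $\mathcal{F}$ over $G=(V,E)$ is a family $\{F_v\}_{v\in V}$ where each $F_v$ is a set of unordered pairs $\{e,e'\}$ of distinct edges with $e\cap e'=\{v\}$; edges $e,e'$ are incompatible if $\{e,e'\}\in F_v$ for some $v$, compatible otherwise. A cycle is compatible with $\mathcal{F}$ if every pair of its edges is compatible. For a positive real $\Delta$, $\mathcal{F}$ is $\Delta$-bounded if for every vertex $v$ and edge $e\ni v$, at most $\Delta$ other edges $e'\ni v$ satisfy $\{e,e'\}\in F_v$. *)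

(* Defs.v *)
From mathcomp Require Import all_boot all_order all_algebra.
Set Implicit Arguments. Unset Strict Implicit. Unset Printing Implicit Defensive.
Import Order.TTheory GRing.Theory Num.Theory.

Definition simple_graph (V : finType) (adj : rel V) : Prop :=
  symmetric adj /\ irreflexive adj.

Definition nbhd (V : finType) (adj : rel V) (v : V) : {set V} := [set y | adj v y].
Definition deg (V : finType) (adj : rel V) (v : V) : nat := #|nbhd adj v|.

(* e(X,Y): number of ordered pairs (x,y) in X x Y with xy an edge
   (so edges inside X ∩ Y are counted twice). *)
Definition e_count (V : finType) (adj : rel V) (X Y : {set V}) : nat :=
  #|[set p : V * V | (p.1 \in X) && (p.2 \in Y) && adj p.1 p.2]|.

(* An incompatibility system is encoded by F : V -> rel V, where F v x y means
   that the pair of edges {vx, vy} belongs to F_v.  Well-formedness: x, y are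
   distinct neighbours of v, and F v is symmetric (the pairs are unordered).
   This is in bijection with families of sets F_v of unordered pairs of
   distinct edges meeting exactly in v. *)
Definition incompat_system (V : finType) (adj : rel V) (F : V -> rel V) : Prop :=
  forall v x y, F v x y -> [/\ adj v x, adj v y, x != y & F v y x].

Definition bounded (R : numDomainType) (V : finType) (adj : rel V)
    (F : V -> rel V) (Delta : R) : Prop :=
  forall v x, adj v x -> ((#|[set y | F v x y]|)%:R <= Delta)%R.

Definition cycle_edge (V : finType) (s : seq V) (x y : V) : bool :=
  has (fun i => ((nth x s i == x) && (nth x s (i.+1 %% size s) == y))
             || ((nth x s i == y) && (nth x s (i.+1 %% size s) == x)))
      (iota 0 (size s)).

Definition hamilton_cycle (V : finType) (adj : rel V) (s : seq V) : Prop :=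
  [/\ uniq s, size s = #|V|, 3 <= size s & cycle adj s].

Definition compatible_cycle (V : finType) (F : V -> rel V) (s : seq V) : Prop :=
  forall v x y, cycle_edge s v x -> cycle_edge s v y -> x != y -> ~~ F v x y.

(* Main.v *)
(* A state is a cyclic order s of all the vertices together with a compatible set
   H of edges of G joining cyclically consecutive vertices; the consecutive pairs
   missing from H are virtual.  A state without virtual pairs is a compatible
   Hamilton cycle, so we enlarge H until it is full.

   Put r = sqrt mu.  Double counting shows that, for all but O(r n) vertices x,
   at most about r n edges xy are incompatible with an edge of H at y; call the
   other vertices bad.  Cut s at a virtual pair and write it v_0, ..., v_l.  If
   both ends are good, let I be the set of p such that v_0 v_{p+1} may be added to
   H, and J the set of p such that v_p v_l may be added.  If I and J meet, then
   one rotation closes the order; so J is nearly the complement of I.  Rotating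
   first at p in I and then at q shows, if no move closes the order, that v_p is
   joined to nearly all of {q > p : q - 1 notin J} and {q < p : q + 1 notin J},
   and to hardly anything else.  Comparing this description for two indices p < q
   in I, either hardly any p in I has p + 1 outside J, and then e(I, I) is small,
   or almost all of them do, and then e(I, J) is small.

   If an end x is bad, pick neighbours v of x and u of v, free v from its edges of
   H, and insert the path x v u at the cost of one edge of H.  All the new ends are
   good, and three closing moves more than make up for the two edges lost at the
   two ends of the virtual pair.

   If mu n < 1, there is no incompatibility and the same moves prove Dirac's
   theorem. *)
Require Import Defs.
From mathcomp Require Import all_boot all_order all_algebra.
From mathcomp Require Import zify lra.
From mathcomp Require Import boolp reals.
Import Order.TTheory GRing.Theory Num.Theory.

Ltac split_ors := repeat match goal with |- is_true (_ || _) -> _ => case/orP end.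

(** * Cyclic orders, their consecutive pairs, and cutting into blocks *)

Section CyclicOrders.
Set Implicit Arguments.
Unset Strict Implicit.
Unset Printing Implicit Defensive.
Variable T : eqType.
Implicit Types (a b c x y : T) (s : seq T).

Definition same_pair a b x y : bool :=
  ((a == x) && (b == y)) || ((a == y) && (b == x)).

Arguments same_pair : simpl never.

Fixpoint walk a s x y : bool :=
  if s is b :: s' then same_pair a b x y || walk b s' x y else false.

(** A boolean disjunction over blocks, so that cutting, reversing and regluing blocks reduces to
    propositional reasoning. *)
Definition cyc s x y : bool :=
  if s is a :: s' then walk a s' x y || same_pair (last a s') a x y else false.

Lemma same_pairC a b x y : same_pair a b x y = same_pair b a x y.
Proof. by rewrite /same_pair orbC ![(b == _) && _]andbC. Qed.

Lemma same_pair_sym a b x y : same_pair a b x y = same_pair a b y x.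
Proof. by rewrite /same_pair orbC. Qed.

Lemma same_pairxx a b : same_pair a b a b.
Proof. by rewrite /same_pair !eqxx. Qed.

Lemma same_pairP a b x y :
  same_pair a b x y -> (x = a /\ y = b) \/ (x = b /\ y = a).
Proof. by case/orP=> /andP[/eqP-> /eqP->]; [left|right]. Qed.

Lemma walk_sym a s x y : walk a s x y = walk a s y x.
Proof. by elim: s a => //= b s IH a; rewrite IH same_pair_sym. Qed.

Lemma cyc_sym s x y : cyc s x y = cyc s y x.
Proof. by case: s => //= a s; rewrite walk_sym same_pair_sym. Qed.

Lemma cyc_ends a s : cyc (a :: s) (last a s) a.
Proof. by rewrite /= same_pairxx orbT. Qed.

Lemma walk_cat a s1 s2 x y :
  walk a (s1 ++ s2) x y = walk a s1 x y || walk (last a s1) s2 x y.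
Proof. by elim: s1 a => //= b s IH a; rewrite IH orbA. Qed.

Lemma walk_rev a s x y : walk (last a s) (rev (belast a s)) x y = walk a s x y.
Proof.
elim: s a => //= b s IH a; rewrite rev_cons -cats1 walk_cat IH orbC; congr (_ || _).
by case: s {IH} => [|c s] /=; rewrite ?rev_cons ?last_rcons orbF same_pairC.
Qed.

Lemma last_rev_belast a s : last (last a s) (rev (belast a s)) = a.
Proof. by case: s => //= b s; rewrite rev_cons last_rcons. Qed.

Lemma rev_lastE a s : rev (a :: s) = last a s :: rev (belast a s).
Proof. by rewrite lastI rev_rcons. Qed.

Lemma cyc_cat2 a s b t x y : cyc ((a :: s) ++ b :: t) x y =
  [|| walk a s x y, walk b t x y, same_pair (last a s) b x y
    | same_pair (last b t) a x y].
Proof.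
rewrite /= walk_cat last_cat /=.
by case: (walk a s x y); case: (walk b t x y); case: (same_pair (last a s) b x y).
Qed.

Lemma cyc_cat3 a s b t c u x y : cyc ((a :: s) ++ (b :: t) ++ c :: u) x y =
  [|| walk a s x y, walk b t x y, walk c u x y, same_pair (last a s) b x y,
      same_pair (last b t) c x y | same_pair (last c u) a x y].
Proof.
rewrite /= walk_cat last_cat /= walk_cat last_cat /=.
case: (walk a s x y); case: (walk b t x y); case: (walk c u x y) => //=;
by case: (same_pair (last a s) b x y); case: (same_pair (last b t) c x y).
Qed.

Lemma cyc_rot s1 s2 x y : cyc (s1 ++ s2) x y = cyc (s2 ++ s1) x y.
Proof.
case: s1 s2 => [|a s] [|b t]; rewrite ?cats0 // !cyc_cat2.
case: (walk a s x y) (walk b t x y) => [] [] //=; exact: orbC.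
Qed.

Lemma cyc_rev s x y : cyc (rev s) x y = cyc s x y.
Proof.
case: s => // a s; rewrite rev_lastE /= walk_rev last_rev_belast.
by rewrite same_pairC.
Qed.

Lemma walk_split a s x y : walk a s x y ->
  exists s1 s2, a :: s = s1 ++ x :: y :: s2 \/ a :: s = s1 ++ y :: x :: s2.
Proof.
elim: s a => //= b s IH a /orP[/same_pairP[][-> ->]|/IH[s1 [s2 E]]].
- by exists [::], s; left.
- by exists [::], s; right.
by exists (a :: s1), s2; case: E => ->; [left|right].
Qed.

(** A rotation brings the pair to the two extremities of the list; a reversal exchanges them if
    needed. *)
Lemma cyc_cut s x y : cyc s x y ->
  exists s', [/\ perm_eq (y :: s') s, last y s' = x
    & forall u v, cyc (y :: s') u v = cyc s u v].
Proof.
have key s1 s2 u v : s = s1 ++ u :: v :: s2 ->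
    let t := s2 ++ rcons s1 u in
    [/\ perm_eq (v :: t) s, last v t = u & cyc (v :: t) =2 cyc s].
  move=> -> /=; split; last 1 first.
  - move=> w z; rewrite -cat_cons -[X in cyc X w z]/((v :: s2) ++ rcons s1 u).
    by rewrite cyc_rot cat_rcons.
  - by rewrite -cat_cons -cat_rcons perm_catC.
  - by rewrite last_cat last_rcons.
have turn u s1 : [/\ perm_eq (u :: s1) s, last u s1 = y & cyc (u :: s1) =2 cyc s] ->
    exists s', [/\ perm_eq (y :: s') s, last y s' = u & cyc (y :: s') =2 cyc s].
  case=> p l c; exists (rev (belast u s1)); rewrite -l; split.
  - by rewrite -rev_lastE perm_rev.
  - exact: last_rev_belast.
  - by move=> w z; rewrite -rev_lastE cyc_rev.
case: s key turn => // a s key turn xy.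
have /orP[/walk_split[s1 [s2 [E|E]]]|] : walk a s x y || same_pair (last a s) a x y by [].
- by eexists; exact: key E.
- exact: turn (key _ _ _ _ E).
case/same_pairP=> -[-> yE]; first by exists s; split; rewrite ?yE.
by apply: turn; split; rewrite ?yE.
Qed.

Lemma next_cat s1 x y s2 : uniq (s1 ++ x :: y :: s2) ->
  next (s1 ++ x :: y :: s2) x = y.
Proof.
move=> U; rewrite -(next_rot (size s1)) // rot_size_cat /= eqxx //.
Qed.

Lemma next_last a s : uniq (a :: s) -> next (a :: s) (last a s) = a.
Proof.
case/lastP: s => [|s b] U; first by rewrite /= eqxx.
rewrite last_rcons -(next_rotr 1 U) -rcons_cons rotr1_rcons /= eqxx //.
Qed.

Lemma cyc_next s x y : uniq s -> cyc s x y -> y = next s x \/ x = next s y.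
Proof.
case: s => // a s U.
move=> xy; have /orP[/walk_split[s1 [s2 [E|E]]]|] :
  walk a s x y || same_pair (last a s) a x y by [].
- by left; rewrite E next_cat // -E.
- by right; rewrite E next_cat // -E.
by case/same_pairP=> -[-> ->]; [left|right]; rewrite next_last.
Qed.

Lemma next_block s1 a s2 b s3 : uniq (s1 ++ (a :: s2) ++ b :: s3) ->
  next (s1 ++ (a :: s2) ++ b :: s3) (last a s2) = b.
Proof. by rewrite lastI cat_rcons catA => /next_cat. Qed.

Lemma next_split a s x : uniq (a :: s) -> x \in a :: s -> x != last a s ->
  exists s1 s2, let y := next (a :: s) x in
  [/\ s = s1 ++ y :: s2, last a s1 = x & last y s2 = last a s].
Proof.
move=> U xs; case/path.splitPl: xs U => s1 [|y s2] lx U.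
  by rewrite cats0 lx eqxx.
have -> : next (a :: s1 ++ y :: s2) x = y.
  by rewrite -lx; apply: (@next_block [::] a s1 y s2).
by move=> _; exists s1, s2; split; rewrite ?last_cat.
Qed.

Lemma index_next a s x : uniq (a :: s) -> x \in a :: s -> x != last a s ->
  index (next (a :: s) x) (a :: s) = (index x (a :: s)).+1.
Proof.
move=> U xs xl; have [s1 [s2 [E lx _]]] := next_split U xs xl.
move: E; set y := next _ _ => E; rewrite E -cat_cons in U *.
rewrite index_cat ifN; last first.
  by move: U; rewrite cat_uniq /= => /and3P[_ /norP[]].
rewrite index_head addn0 -lx index_cat mem_last index_last //.
by move: U; rewrite cat_uniq => /andP[].
Qed.

(** Cuts the order after [x] and after [y], into the three blocks that the closing moves
    rearrange. *)
Lemma next_split2 a s x y : uniq (a :: s) -> y \in a :: s ->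
  index x (a :: s) < index y (a :: s) -> y != last a s ->
  exists s1 s2 s3, let u := next (a :: s) x in let v := next (a :: s) y in
  [/\ s = s1 ++ (u :: s2) ++ v :: s3, last a s1 = x, last u s2 = y
    & last v s3 = last a s].
Proof.
move=> U ys xy yl.
have xs : x \in a :: s by rewrite -index_mem (ltn_trans xy) ?index_mem.
have xl : x != last a s.
  by apply: contraTneq xy => ->; rewrite index_last // -leqNgt -ltnS index_mem.
have [s1 [s2 [E lx ls]]] := next_split U xs xl.
set u := next _ x in E ls *; have: y \in u :: s2.
  move: ys; rewrite E -cat_cons mem_cat => /orP[ys|//].
  move: xy; rewrite E -cat_cons !index_cat -lx mem_last ys index_last; last first.
    by move: U; rewrite E -cat_cons cat_uniq => /andP[].
  by rewrite ltnNge -ltnS index_mem ys.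
move=> ys2; case/path.splitPl: ys2 E ls => t1 [|v t2] ly E ls.
  by rewrite -ls cats0 -ly eqxx in yl.
have vE : next (a :: s) y = v.
  by rewrite -ly E -cat_cons; apply: next_block; rewrite cat_cons -E.
by exists s1, t1, t2; rewrite vE; split=> //; rewrite -ls last_cat.
Qed.

Lemma cyc_cycle s (e : rel T) : (forall x y, cyc s x y -> e x y) -> cycle e s.
Proof.
have walk_path a t : (forall x y, walk a t x y -> e x y) -> path e a t.
  elim: t a => //= b t IH a h; rewrite h ?same_pairxx //=.
  by apply: IH => x y xy; apply: h; rewrite xy orbT.
case: s => //= a s h; apply: walk_path => x y.
by rewrite -cats1 walk_cat /= orbF => /h.
Qed.

Lemma cyc_nth x0 s i : i < size s ->
  cyc s (nth x0 s i) (nth x0 s (i.+1 %% size s)).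
Proof.
move=> lt; rewrite -{1}(cat_take_drop i s) cyc_rot (drop_nth x0 lt).
case: (ltngtP i.+1 (size s)) => [lt1|gt1|eq1].
- by rewrite modn_small // (drop_nth x0 lt1) /= same_pairxx.
- by move: lt gt1; clear; lia.
rewrite eq1 modnn drop_size; case: i lt eq1 => [|i] lt eq1.
  by rewrite take0 /= same_pairxx.
by case: s lt {eq1} => //= a s lt; rewrite same_pairxx.
Qed.

End CyclicOrders.

Arguments same_pair : simpl never.

(** * Symmetric sets of pairs and matchings *)

Section PairSets.
Set Implicit Arguments.
Unset Strict Implicit.
Unset Printing Implicit Defensive.
Variable V : finType.
Implicit Types (l : seq (V * V)) (x y : V).

Definition edges l : {set V * V} := [set p | (p \in l) || ((p.2, p.1) \in l)].

(** Used through [uniq (ends l)], which says that [l] is a matching. *)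
Definition ends l : seq V := flatten [seq [:: p.1; p.2] | p <- l].

Lemma edges_sym l x y : ((x, y) \in edges l) = ((y, x) \in edges l).
Proof. by rewrite !inE orbC. Qed.

Lemma edges_cons x y l : edges ((x, y) :: l) = [set (x, y); (y, x)] :|: edges l.
Proof.
apply/setP=> -[u v]; rewrite !inE !xpair_eqE /= orbACA.
by rewrite [(v == x) && _]andbC.
Qed.

Lemma mem_edges l x y :
  ((x, y) \in edges l) = has (fun p => same_pair p.1 p.2 x y) l.
Proof.
elim: l => [|[a b] l IH]; first by rewrite !inE.
rewrite edges_cons in_setU IH /= !inE !xpair_eqE /same_pair.
by rewrite ![x == _]eq_sym ![y == _]eq_sym [(b == x) && _]andbC.
Qed.

Lemma mem_edges1 a b x y : ((x, y) \in edges [:: (a, b)]) = same_pair a b x y.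
Proof. by rewrite mem_edges /= orbF. Qed.

Lemma edges_ends l x y : (x, y) \in edges l -> x \in ends l /\ y \in ends l.
Proof.
have key u v : (u, v) \in l -> u \in ends l /\ v \in ends l.
  by move=> uvl; split; apply/flatten_mapP; exists (u, v); rewrite // !inE eqxx ?orbT.
by rewrite inE => /orP[] /key[].
Qed.

Lemma card_edges_le l : #|edges l| <= 2 * size l.
Proof.
elim: l => [|[x y] l IH]; first by rewrite leqn0 cards_eq0; apply/eqP/setP => p; rewrite !inE.
rewrite edges_cons (leq_trans (leq_card_setU _ _)) // mulnS leq_add //.
by rewrite cards2; case: (_ != _).
Qed.

Lemma card_edges l : uniq (ends l) -> #|edges l| = 2 * size l.
Proof.
elim: l => [|[x y] l IH] /=; first by move=> _; apply/eqP; rewrite -leqn0 card_edges_le.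
rewrite inE negb_or => /and3P[/andP[xy xl] yl ul].
rewrite edges_cons cardsU (_ : _ :&: _ = set0) ?cards0 ?subn0; last first.
  apply/setP=> -[u v]; rewrite in_set0; apply/negP=> /setIP[].
  by rewrite !in_set2 !xpair_eqE => /orP[] /andP[/eqP-> /eqP->]
    /edges_ends[]; rewrite ?(negPf xl) ?(negPf yl).
by rewrite IH // cards2 xpair_eqE (negPf xy) mulnS.
Qed.

(** In a matching a vertex lies in at most one pair, so two new edges never conflict with each
    other. *)
Lemma edges_inj l x y z : uniq (ends l) ->
  (x, y) \in edges l -> (x, z) \in edges l -> y = z.
Proof.
elim: l => [|[a b] l IH] /=; first by rewrite inE.
rewrite inE negb_or => /and3P[/andP[ab al] bl ul].
rewrite edges_cons !in_setU !in_set1 !xpair_eqE.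
case/orP=> [xy|xyl]; case/orP=> [xz|xzl]; last exact: IH.
- case/orP: xy xz => /andP[/eqP-> /eqP->];
    by rewrite eqxx ?[b == a]eq_sym (negPf ab) /= ?orbF => /eqP.
- by have [xl _] := edges_ends xzl;
    case/orP: xy => /andP[/eqP xE _]; rewrite xE ?(negPf al) ?(negPf bl) in xl.
- by have [xl _] := edges_ends xyl;
    case/orP: xz => /andP[/eqP xE _]; rewrite xE ?(negPf al) ?(negPf bl) in xl.
Qed.

End PairSets.

(** * States, the general rewiring move, and counting around a vertex *)

Section States.
Set Implicit Arguments.
Unset Strict Implicit.
Unset Printing Implicit Defensive.
Variables (V : finType) (adj : rel V) (F : V -> rel V) (D : nat).
Hypothesis adjC : symmetric adj.
Hypothesis Fsys : incompat_system adj F.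
Hypothesis FD : forall v x, #|[set y | F v x y]| <= D.
Implicit Types (s : seq V) (H : {set V * V}) (Z : {set V}) (l e : seq (V * V)).

Lemma F_irr v x : F v x x = false.
Proof. by apply/negP=> /Fsys[_ _]; rewrite eqxx. Qed.

Lemma F_sym v x y : F v x y = F v y x.
Proof. by apply/idP/idP=> /Fsys[]. Qed.

(** [H] is a symmetric set of ordered pairs, so [#|H|] is twice the number of edges; hence the
    factors 2 in later counts. *)
Definition state s H : Prop :=
  [/\ uniq s, s =i V,
      forall x y, (x, y) \in H -> [&& adj x y, (y, x) \in H & cyc s x y]
    & forall v x y, (v, x) \in H -> (v, y) \in H -> ~~ F v x y].

(** Compatibility is asked with all of [H], even with edges that a move is about to break, so the
    notion does not depend on the move. Such a pair is called admissible below. *)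
Definition ok H x y : bool :=
  [&& adj x y, (x, y) \notin H &
   [forall w, (((y, w) \in H) ==> ~~ F y x w) && (((x, w) \in H) ==> ~~ F x y w)]].

(** Only conflicts at the far end [y] are recorded; those at [x] number at most [2 * D] and are
    counted apart. *)
Definition badset H x : {set V} :=
  [set y | [exists w, ((y, w) \in H) && F y x w]].

Definition virt s H x y : bool := cyc s x y && ((x, y) \notin H).

Lemma okP H x y : reflect
  [/\ adj x y, (x, y) \notin H, forall w, (y, w) \in H -> ~~ F y x w
    & forall w, (x, w) \in H -> ~~ F x y w] (ok H x y).
Proof.
apply: (iffP and3P) => [[a n /forallP f]|[a n f g]]; split=> //.
- by move=> w yw; have /andP[/implyP->] := f w.
- by move=> w xw; have /andP[_ /implyP->] := f w.
by apply/forallP=> w; apply/andP; split; apply/implyP; [apply: f|apply: g].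
Qed.

Lemma state_sym s H x y : state s H -> ((x, y) \in H) = ((y, x) \in H).
Proof. by case=> _ _ S _; apply/idP/idP=> /S /and3P[]. Qed.

Lemma state_cyc s H x y : state s H -> (x, y) \in H -> cyc s x y.
Proof. by case=> _ _ S _ /S /and3P[]. Qed.

Lemma ok_sym s H x y : state s H -> ok H x y = ok H y x.
Proof.
move=> S; rewrite /ok adjC (state_sym x y S); congr [&& _, _ & _].
by apply: eq_forallb => w; rewrite andbC.
Qed.

Lemma state_eq_cyc s s' H : state s H -> perm_eq s' s -> cyc s' =2 cyc s ->
  state s' H.
Proof.
case=> U A S C p c; split=> //; first by rewrite (perm_uniq p).
  by move=> x; rewrite (perm_mem p) A.
by move=> x y /S; rewrite c.
Qed.

Lemma badset_edges H H' l x : H' \subset H :|: edges l ->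
  #|badset H' x| <= #|badset H x| + 2 * size l.
Proof.
move=> sub; apply: (@leq_trans #|badset H x :|: [set p.1 | p in edges l]|).
  apply/subset_leq_card/subsetP=> y; rewrite !inE => /existsP[w /andP[yw f]].
  have /setUP[yH|yl] := subsetP sub _ yw.
    by apply/orP; left; apply/existsP; exists w; rewrite yH.
  by apply/orP; right; apply/imsetP; exists (y, w).
rewrite (leq_trans (leq_card_setU _ _)) // leq_add2l.
exact: leq_trans (leq_imset_card _ _) (card_edges_le _).
Qed.

(* [Z] carries the virtual pairs that must survive the move; [e] may list more
   pairs than are actually broken. *)
Lemma rewire Z s H s' l e : state s H -> perm_eq s' s -> uniq (ends l) ->
  (forall x y, (x, y) \in l -> ok H x y && cyc s' x y) ->
  (forall x y, cyc s x y -> cyc s' x y || ((x, y) \in edges e)) ->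
  (forall x y, (x, y) \in l ++ e -> (x \notin Z) || (y \notin Z)) ->
  exists H', [/\ state s' H', #|H| + 2 * size l <= #|H'| + 2 * count (mem H) e,
    H' \subset H :|: edges l
    & forall c d, c \in Z -> d \in Z -> virt s H c d -> virt s' H' c d].
Proof.
move=> S ps U okl brk offZ; have [Us As Hs Cs] := S.
have okS x y : (x, y) \in edges l -> ok H x y && cyc s' x y.
  rewrite inE /= => /orP[/okl //|/okl].
  by rewrite (ok_sym y x S) cyc_sym.
(* The new set keeps the edges of [H] still consecutive in [s'] and adds the pairs of [l]. *)
pose K := H :&: [set p | cyc s' p.1 p.2].
exists (K :|: edges l); split.
- split; first by rewrite (perm_uniq ps).
  + by move=> x; rewrite (perm_mem ps) As.
  + move=> x y /setUP[/setIP[xyH]|xyl].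
      rewrite in_set => /= c; have /and3P[a yxH _] := Hs _ _ xyH.
      by rewrite a c andbT; rewrite in_setU in_setI yxH in_set /= cyc_sym c.
    have /andP[/and3P[a _ _] c] := okS _ _ xyl.
    by rewrite a c andbT in_setU [(_, _) \in edges _]edges_sym xyl orbT.
  + move=> v x y /setUP[/setIP[vx _]|vx] /setUP[/setIP[vy _]|vy].
    * exact: Cs vx vy.
    * have /andP[/okP[_ _ _ f] _] := okS _ _ vy.
      by rewrite F_sym f.
    * by have /andP[/okP[_ _ _ f] _] := okS _ _ vx; rewrite f.
    * by rewrite (edges_inj U vx vy) F_irr.
- have dis : K :&: edges l = set0.
    apply/setP=> -[x y]; rewrite in_set0; apply/negP=> /setIP[/setIP[xyH _] xyl].
    by have /andP[/okP[_ /negP]] := okS _ _ xyl.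
  rewrite cardsU dis cards0 subn0 (card_edges U) addnAC leq_add2r.
  rewrite -(cardsID [set p | cyc s' p.1 p.2] H) leq_add2l -size_filter.
  apply: leq_trans (card_edges_le _); apply/subset_leq_card/subsetP=> -[x y].
  rewrite !in_setD !in_set /= => /andP[nc xyH].
  have := brk _ _ (state_cyc S xyH); rewrite (negPf nc) /= inE /= !mem_filter /=.
  by rewrite -(state_sym x y S) xyH.
- by apply/subsetP=> p /setUP[/setIP[pH _]|pl]; rewrite inE ?pH ?pl ?orbT.
move=> c d cZ dZ /andP[ccd ncd].
(* No pair of [e] or [l] lies inside [Z], so a virtual pair inside [Z] is neither broken nor
   filled. *)
have away m : (forall x y, (x, y) \in m -> (x \notin Z) || (y \notin Z)) ->
    (c, d) \notin edges m.
  by move=> h; rewrite inE; apply/norP; split; apply/negP=> /h; rewrite cZ dZ.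
have := brk _ _ ccd; rewrite (negPf (away e _)) ?orbF => [cs'|]; last first.
  by move=> x y h; apply: offZ; rewrite mem_cat h orbT.
rewrite /virt cs' !inE /= (negPf ncd) /=.
by have := away l; rewrite inE; apply=> x y h; apply: offZ; rewrite mem_cat h.
Qed.

Lemma card_mem_nbrs s H x : state s H -> #|[set y | (x, y) \in H]| <= 2.
Proof.
move=> S; have [U _ _ _] := S.
apply: (@leq_trans #|[set next s x; prev s x]|); last by rewrite cards2; case: (_ != _).
apply/subset_leq_card/subsetP=> y; rewrite !inE => /(state_cyc S)/(cyc_next U)[->|->].
  by rewrite eqxx.
by rewrite prev_next // eqxx orbT.
Qed.

Lemma card_state s H : state s H -> #|H| <= 2 * #|V|.
Proof.
move=> S; have [U _ _ _] := S; rewrite mul2n -addnn.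
apply: (@leq_trans #|[set (x, next s x) | x : V] :|: [set (next s x, x) | x : V]|).
  apply/subset_leq_card/subsetP=> -[x y] /(state_cyc S)/(cyc_next U)[->|->].
    by rewrite inE imset_f.
  by rewrite inE orbC; rewrite (imset_f (fun x => (next s x, x))).
by rewrite (leq_trans (leq_card_setU _ _)) // leq_add // leq_imset_card.
Qed.

Lemma card_F_partners s H x : state s H ->
  #|[set y | [exists w, ((x, w) \in H) && F x y w]]| <= 2 * D.
Proof.
move=> S; have [U _ _ _] := S.
apply: (@leq_trans #|[set y | F x (next s x) y] :|: [set y | F x (prev s x) y]|).
  apply/subset_leq_card/subsetP=> y; rewrite !inE => /existsP[w /andP[xw]].
  rewrite F_sym; case/(state_cyc S)/(cyc_next U): xw => [->|xE]; first by move->.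
  by have -> : w = prev s x; [rewrite xE prev_next | move=> ->; rewrite orbT].
by rewrite (leq_trans (leq_card_setU _ _)) // mul2n -addnn leq_add.
Qed.

(** A neighbour fails for one of three reasons: a conflict at the far end, a conflict at [x], or
    membership in [H]. *)
Lemma card_not_ok s H x : state s H ->
  #|nbhd adj x :\: [set y | ok H x y]| <= #|badset H x| + 2 * D + 2.
Proof.
move=> S.
set B := [set y | [exists w, ((x, w) \in H) && F x y w]].
set C := [set y | (x, y) \in H].
apply: (@leq_trans #|badset H x :|: B :|: C|).
  apply/subset_leq_card/subsetP=> y; rewrite /B /C !inE => /andP[+ xy].
  apply: contraR; rewrite !negb_or => /andP[/andP[/existsPn n1 /existsPn n2] nxy].
  apply/okP; split=> // w wH; first by have := n1 w; rewrite wH.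
  by have := n2 w; rewrite wH F_sym.
rewrite (leq_trans (leq_card_setU _ _)) // leq_add ?(card_mem_nbrs x S) //.
by rewrite (leq_trans (leq_card_setU _ _)) // leq_add2l (card_F_partners x S).
Qed.

Lemma deg_ok s H x : state s H ->
  deg adj x <= #|[set y | ok H x y]| + #|badset H x| + 2 * D + 2.
Proof.
move=> S; rewrite /deg -(cardsID [set y | ok H x y] (nbhd adj x)).
have := card_not_ok x S.
have := subset_leq_card (subsetIr (nbhd adj x) [set y | ok H x y]).
lia.
Qed.

Definition bad t H : {set V} := [set x | t < #|badset H x|].

(* Double counting of the triples (x, y, w) with yw in H and {yx, yw} in F_y. *)
Lemma card_bad t s H : state s H -> D * #|V| <= t ^ 2 -> #|bad t H| <= 2 * t.
Proof.
move=> S Dn.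
have le1 : #|bad t H| * t.+1 <= \sum_x #|badset H x|.
  rewrite -sum_nat_const [leqRHS](bigID [pred x | x \in bad t H]) /=.
  apply: leq_trans (leq_addr _ _); apply: leq_sum => x.
  by rewrite inE.
have le2 : \sum_x #|badset H x| <= \sum_x \sum_(p in H) F p.1 p.2 x.
  apply: leq_sum => x _.
  apply: (@leq_trans #|[set p.1 | p in [set p in H | F p.1 p.2 x]]|).
    apply/subset_leq_card/subsetP=> y; rewrite inE => /existsP[w /andP[yw f]].
    by apply/imsetP; exists (y, w); rewrite // inE yw F_sym.
  rewrite (leq_trans (leq_imset_card _ _)) // -sum1dep_card.
  by rewrite big_mkcondr /= leq_sum // => p _; case: (F _ _ _).
have le3 : \sum_x \sum_(p in H) F p.1 p.2 x <= #|H| * D.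
  rewrite exchange_big -sum_nat_const /=; apply: leq_sum => p _.
  apply: leq_trans (FD p.1 p.2); rewrite -sum1dep_card [leqRHS]big_mkcond /=.
  by apply: leq_sum => x _; case: (F _ _ _).
(* Together, [t + 1] times the number of bad vertices is at most [2 * D * #|V|], hence at most
   [2 * t ^ 2]. *)
have := card_state S; move: le1 le2 le3 Dn; rewrite -mulnn.
move: #|bad t H| #|H| #|V| => B h n; nia.
Qed.

Lemma card_setU_le (T : finType) (A B : {set T}) : #|A :|: B| <= #|A| + #|B|.
Proof. exact: leq_card_setU. Qed.

Lemma ex_notin (T : finType) (A B : {set T}) : #|B| < #|A| ->
  exists2 x, x \in A & x \notin B.
Proof.
rewrite ltnNge => /(contra (@subset_leq_card _ A B)).
by case/subsetPn=> x; exists x.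
Qed.

Lemma card_incident s H v : state s H ->
  #|H| <= #|H :\: [set p | (p.1 == v) || (p.2 == v)]| + 4.
Proof.
move=> S; rewrite -(cardsID [set p : V * V | (p.1 == v) || (p.2 == v)] H) addnC leq_add2l.
have N2 := card_mem_nbrs v S; set N := [set y | _] in N2.
apply: (@leq_trans #|[set (v, y) | y in N] :|: [set (y, v) | y in N]|).
  apply/subset_leq_card/subsetP=> -[x y]; rewrite !inE /= => /andP[xyH].
  case/orP=> /eqP E; rewrite {}E in xyH *; apply/orP; [left|right]; apply: imset_f.
    by rewrite inE.
  by rewrite inE (state_sym _ _ S).
rewrite (leq_trans (card_setU_le _ _)) // -[4]/(2 + 2).
by rewrite leq_add // (leq_trans (leq_imset_card _ _)).
Qed.

(** * Replacing an end of a virtual pair by a good vertex *)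

(** In the application [t] is about [sqrt mu * n] and [D] is the integer part of [mu * n]. *)
Variable t : nat.
Hypothesis Dn : D * #|V| <= t ^ 2.
Hypothesis tD : 100 * D <= t.
Hypothesis t_ge : 400 <= t.
Hypothesis tn : 100 * t <= #|V|.
Hypothesis adj_deg : forall v, #|V| <= 2 * deg adj v.
Hypothesis adj0 : irreflexive adj.

(** As [x] may be bad, a neighbour [v] is stripped of its edges of [H] and moved in front of [x]:
    the edge [v x] can then conflict with [H] only at [x]. The old neighbours [c], [d] of [v] become
    a virtual pair. At most two edges are lost and one is gained. *)
Lemma detach Z x s H : state (x :: s) H -> (last x s, x) \notin H ->
  #|Z| <= 4 -> last x s \notin Z ->
  exists v s' c d H',
  [/\ state (v :: s') H', last v s' = last x s, (last x s, v) \notin H',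
      virt (v :: s') H' c d & #|H| <= #|H'| + 2] /\
  [/\ forall c d, c \in Z -> d \in Z -> virt (x :: s) H c d -> virt (v :: s') H' c d,
      forall w, #|badset H' w| <= #|badset H w| + 2,
      forall w, w \in [:: c; d; v] ->
        [&& #|badset H w| <= t, w \notin Z & w != last x s]
    & (v != c) && (v != d)].
Proof.
move=> S; set b := last x s => bx Z4 bZ; have [U A _ _] := S.
set W := bad t H :|: Z :|: [set x; b].
have W_le : #|W| <= 2 * t + 6.
  have := card_bad S Dn; have := card_setU_le (bad t H) Z.
  have := card_setU_le (bad t H :|: Z) [set x; b]; rewrite cards2 -/W.
  by case: (x != b); lia.
set P := [set y | [exists w, ((x, w) \in H) && F x y w]].
(* [v] and both its neighbours in the order must avoid [W], and [x v] must not conflict with [H] at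
   [x]. *)
have [v] : exists2 v, v \in nbhd adj x & v \notin
    W :|: (next (x :: s) @: W) :|: (prev (x :: s) @: W) :|: P.
  apply: ex_notin; have := card_F_partners x S; have := adj_deg x.
  rewrite -/P /deg; move: #|nbhd _ _| => dx.
  have := leq_imset_card (next (x :: s)) W; have := leq_imset_card (prev (x :: s)) W.
  have := card_setU_le W (next (x :: s) @: W).
  have := card_setU_le (W :|: (next (x :: s) @: W)) (prev (x :: s) @: W).
  have := card_setU_le (W :|: (next (x :: s) @: W) :|: (prev (x :: s) @: W)) P.
  lia.
rewrite inE => xv; rewrite 3!in_setU !negb_or => /andP[/andP[/andP[vW vnW] vpW] vP].
pose c := prev (x :: s) v; pose d := next (x :: s) v.
have cW : c \notin W.
  by apply: contra vnW => cW; apply/imsetP; exists c; rewrite // /c next_prev.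
have dW : d \notin W.
  by apply: contra vpW => dW; apply/imsetP; exists d; rewrite // /d prev_next.
have nW y : y \notin W -> [/\ #|badset H y| <= t, y \notin Z, y != x & y != b].
  by rewrite !inE !negb_or -leqNgt => /andP[/andP[-> ->] /andP[-> ->]].
have [v_bad vZ vx vb] := nW _ vW.
have [c_bad cZ cx cb] := nW _ cW; have [d_bad dZ dx db] := nW _ dW.
have nc : next (x :: s) c = v by rewrite /c next_prev.
have ic := index_next U (A c) cb; have iv := index_next U (A v) vb.
have idd := index_next U (A d) db; rewrite nc in ic; rewrite -/d in iv.
have nd : next (x :: s) v = d by [].
clearbody c d;
(* None of [c], [v], [d] is the last vertex, so their positions are successive and [c d] was not a
   consecutive pair. *)
have cd_H : (c, d) \notin H.
  apply/negP=> /(state_cyc S)/(cyc_next U)[E|E].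
    by move: iv; rewrite E nc; clear; lia.
  by move: idd ic iv; rewrite -E; clear; lia.
have cv : c != v by apply: contra_eq_neq ic => ->; clear; lia.
have dv : d != v by apply: contra_eq_neq iv => ->; clear; lia.
have := next_split U (A c) cb; rewrite nc => -[s1 [s2' [Es lc ls2]]].
case: s2' Es ls2 => [|d' s2] Es ls2; first by rewrite /b -ls2 eqxx in vb.
have Ed : d' = d.
  by rewrite -nd; apply/esym; move: U; rewrite Es; exact: (@next_cat _ (x :: s1)).
subst d'; have ls2b : last d s2 = b := ls2.
pose N := [set p : V * V | (p.1 == v) || (p.2 == v)]; pose H0 := H :\: N.
have S0 : state (x :: s) H0.
  split=> // [y z|w y z /setDP[yH _] /setDP[zH _]]; last by case: S => _ _ _; apply.
  case/setDP=> yzH nyz; have [_ _ /(_ _ _ yzH) /and3P[ayz zyH cyz] _] := S.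
  by apply/and3P; split; rewrite // inE zyH andbT; move: nyz; rewrite !inE orbC.
have vH0 y : (v, y) \in H0 = false by rewrite !inE /= eqxx.
have H0v y : (y, v) \in H0 = false by rewrite !inE /= eqxx orbT.
have bx0 : (b, x) \notin H0 by rewrite in_setD (negPf bx) andbF.
have xb : b != x.
  apply/negP=> /eqP E; move: U (A v); rewrite Es -E /= => /andP[bs _].
  by move: bs; rewrite /b Es last_cat /= mem_cat [_ \in v :: _]in_cons mem_last !orbT.
have [|||||H1 [S1 H1_ge H1_sub H1_Z]] := @rewire Z (x :: s) H0
  (v :: (x :: s1) ++ d :: s2) [:: (v, x)] [:: (c, v); (v, d); (b, x)] S0.
- by apply/permP=> p; rewrite Es /= !count_cat /=; clear; lia.
- by rewrite /= inE vx.
- move=> y z; rewrite inE xpair_eqE => /andP[/eqP-> /eqP->].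
  have -> : cyc (v :: (x :: s1) ++ d :: s2) v x.
    by rewrite (cyc_cat3 v [::]) /= same_pairxx !orbT.
  rewrite andbT; apply/okP; split=> [||w xw|w]; rewrite ?vH0 //; first by rewrite adjC.
  apply: contra vP => Fxvw; rewrite inE; apply/existsP; exists w.
  by move: xw; rewrite in_setD => /andP[_ ->].
- move=> y z; rewrite Es (cyc_cat3 x s1 v [::]) (cyc_cat3 v [::]) /= lc.
  by rewrite mem_edges /= ls2b; split_ors; move=> ->; rewrite ?orbT.
- move=> y z; rewrite !inE !xpair_eqE.
  by split_ors; case/andP=> /eqP-> /eqP->; rewrite ?vZ ?bZ ?orbT.
have H1H : H1 \subset H :|: edges [:: (v, x)].
  by rewrite (subset_trans H1_sub) // setSU // subsetDl.
exists v, ((x :: s1) ++ d :: s2), c, d, H1; split; split=> //.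
- by rewrite last_cat.
- apply/negP=> /(subsetP H1_sub); rewrite in_setU H0v mem_edges1.
  by rewrite /same_pair (negPf vb) [x == b]eq_sym (negPf xb) andbF.
- rewrite /virt (cyc_cat3 v [::]) lc same_pairxx !orbT /=.
  apply/negP=> /(subsetP H1_sub); rewrite in_setU in_setD (negPf cd_H) andbF.
  by rewrite mem_edges1 /same_pair ![v == _]eq_sym (negPf cv) (negPf dv).
- have := card_incident v S; rewrite -/N -/H0; move: H1_ge.
  by rewrite /= vH0 H0v (negPf bx0) /=; clear; lia.
- move=> y z yZ zZ /andP[yz nyz]; apply: H1_Z => //; rewrite /virt yz.
  by rewrite in_setD (negPf nyz) andbF.
- by move=> w; apply: leq_trans (badset_edges w H1H) _.
- move=> w; rewrite !inE => /or3P[] /eqP->; rewrite ?v_bad ?c_bad ?d_bad.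
  + by rewrite cZ cb.
  + by rewrite dZ db.
  + by rewrite vZ vb.
by rewrite eq_sym cv eq_sym dv.
Qed.

(** Rotation at the head: for an admissible [v u], reversing the block from [v] to the predecessor
    [y] of [u] trades [y u] for [v u] and makes [y] the head. There are enough choices of [u] for
    [y] to be good. *)
Lemma rotate_head Z v s H : state (v :: s) H -> (last v s, v) \notin H ->
  #|Z| <= 8 -> v \notin Z -> #|badset H v| <= t + 2 ->
  exists y s' H',
  [/\ state (y :: s') H', last y s' = last v s, (last v s, y) \notin H',
      #|H| <= #|H'| & #|badset H y| <= t] /\
  [/\ forall c d, c \in Z -> d \in Z -> virt (v :: s) H c d -> virt (y :: s') H' c d,
      forall w, #|badset H' w| <= #|badset H w| + 2,
      y \notin Z & y != last v s].
Proof.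
move=> S; set b := last v s => bv Z8 vZ v_bad; have [U A _ _] := S.
(* The new closing pair [b y] has to be virtual, so [y] is taken outside [N]. *)
pose N := [set y | (b, y) \in H].
set W := bad t H :|: Z :|: [set v; b] :|: N.
have W_le : #|W| <= 2 * t + 12.
  have := card_bad S Dn; have := card_setU_le (bad t H) Z.
  have := card_setU_le (bad t H :|: Z) [set v; b]; rewrite cards2.
  have := card_setU_le (bad t H :|: Z :|: [set v; b]) N; rewrite -/W.
  have := card_mem_nbrs b S; rewrite -/N.
  by case: (v != b); lia.
have [u] : exists2 u, u \in [set y | ok H v y] & u \notin (next (v :: s) @: W).
  apply: ex_notin; have := deg_ok v S; have := adj_deg v.
  have := leq_imset_card (next (v :: s)) W.
  by lia.
rewrite inE => vu unW; pose y := prev (v :: s) u.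
have : y \notin W.
  by apply: contra unW => yW; apply/imsetP; exists y; rewrite // /y next_prev.
rewrite !inE !negb_or -leqNgt => /andP[/andP[/andP[y_bad yZ] /andP[yv yb]] byH].
have ny : next (v :: s) y = u by rewrite /y next_prev.
clearbody y; have [s1 [s2]] := next_split U (A y) yb; rewrite ny => -[Es ly ls].
have uv : v != u by apply: contraTneq vu => <-; rewrite /ok adj0.
have lb : last u s2 = b := ls.
have vb : v != b.
  apply: contraTneq U => ->; rewrite Es -lb /= negb_and negbK.
  by rewrite mem_cat mem_last orbT.
have [|||||H1 [S1 H1_ge H1_sub H1_Z]] := @rewire Z (v :: s) H
  ((y :: rev (belast v s1)) ++ u :: s2) [:: (v, u)] [:: (y, u); (b, v)] S.
- rewrite -ly -rev_lastE Es -cat_cons perm_cat2r perm_rev; exact: perm_refl.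
- by rewrite /= inE uv.
- move=> w z; rewrite inE xpair_eqE => /andP[/eqP-> /eqP->].
  by rewrite vu cyc_cat2 -ly last_rev_belast same_pairxx !orbT.
- move=> w z; rewrite Es -cat_cons !cyc_cat2 -ly walk_rev ly lb mem_edges /=.
  by split_ors; move=> ->; rewrite ?orbT.
- move=> w z; rewrite !inE !xpair_eqE.
  by split_ors; case/andP=> /eqP-> /eqP->; rewrite ?vZ ?yZ ?orbT.
exists y, (rev (belast v s1) ++ u :: s2), H1; split; split=> //.
- by rewrite last_cat.
- apply/negP=> /(subsetP H1_sub); rewrite in_setU (negPf byH) mem_edges1 /same_pair.
  by rewrite [v == y]eq_sym (negPf yv) (negPf vb).
- by move: H1_ge; rewrite /= (negPf bv) addn0; case: (_ \in H) => /=; clear; lia.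
- by move=> w; apply: leq_trans (badset_edges w H1_sub) _.
Qed.

(** [detach] followed by [rotate_head], with [c] and [d] protected during the rotation so that their
    virtual pair survives it. *)
Lemma fix_end Z x s H : state (x :: s) H -> (last x s, x) \notin H ->
  #|Z| <= 4 -> last x s \notin Z ->
  exists y s' c d H',
  [/\ state (y :: s') H', last y s' = last x s, (last x s, y) \notin H',
      virt (y :: s') H' c d & #|H| <= #|H'| + 2] /\
  [/\ forall c d, c \in Z -> d \in Z -> virt (x :: s) H c d -> virt (y :: s') H' c d,
      forall w, #|badset H' w| <= #|badset H w| + 4,
      forall w, w \in [:: c; d; y] ->
        [&& #|badset H' w| <= t + 4, w \notin Z & w != last x s]
    & (y != c) && (y != d)].
Proof.
move=> S bx Z4 bZ.
have [v [s1 [c [d [H1 [[S1 l1 b1 cd1 H1_ge] [Z1 bad1 cdv /andP[vc vd]]]]]]]] :=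
  detach S bx Z4 bZ.
have /and3P[v_bad vZ vb] : [&& #|badset H v| <= t, v \notin Z & v != last x s].
  by apply: cdv; rewrite !inE eqxx !orbT.
have [||||y [s2 [H2 [[S2 l2 b2 H2_ge y_bad] [Z2 bad2 yZ yb]]]]] :=
  @rotate_head (Z :|: [set c; d]) v s1 H1 S1.
- by rewrite l1.
- by have := card_setU_le Z [set c; d]; rewrite cards2; move: Z4; case: (c != d); clear; lia.
- by rewrite !inE !negb_or vZ vc vd.
- by apply: leq_trans (bad1 v) _; rewrite leq_add2r.
move: yZ; rewrite !inE !negb_or => /andP[yZ /andP[yc yd]].
have bad12 w : #|badset H2 w| <= #|badset H w| + 4.
  by have := bad1 w; have := bad2 w; clear; lia.
exists y, s2, c, d, H2; rewrite l2 l1 in b2 yb *; split; split=> //.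
- by apply: Z2 => //; rewrite !inE eqxx !orbT.
- by move: H1_ge H2_ge; clear; lia.
- by move=> a e aZ eZ ae; apply: Z2; rewrite ?inE ?aZ ?eZ //; apply: Z1.
- move=> w; rewrite !inE => /or3P[wE|wE|/eqP->].
  + have /and3P[wb -> ->] : [&& #|badset H w| <= t, w \notin Z & w != last x s].
      by apply: cdv; rewrite !inE wE.
    by rewrite (leq_trans (bad12 w)) ?leq_add2r.
  + have /and3P[wb -> ->] : [&& #|badset H w| <= t, w \notin Z & w != last x s].
      by apply: cdv; rewrite !inE wE orbT.
    by rewrite (leq_trans (bad12 w)) ?leq_add2r.
  + by rewrite yZ yb !andbT; move: (bad2 y) y_bad; clear; lia.
by rewrite yc yd.
Qed.

(** * Structure of a state that no closing move improves *)

Lemma card_pairs_le (A : {set V}) (R : rel V) c :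
  (forall x, x \in A -> #|[set y | R x y]| <= c) ->
  #|[set p : V * V | (p.1 \in A) && R p.1 p.2]| <= #|A| * c.
Proof.
move=> h; rewrite -sum1dep_card -(pair_big_dep (mem A) R (fun _ _ => 1)) /=.
rewrite -sum_nat_const leq_sum // => x xA.
by rewrite sum1dep_card h.
Qed.

(** Integer form of the second alternative, with [t] for [sqrt mu * n]; the constants leave room for
    rounding. *)
Definition extremal : Prop := exists A B : {set V},
  [/\ #|V| <= 2 * #|A| + 40 * t, #|V| <= 2 * #|B| + 40 * t
    & e_count adj A B <= 15 * t * #|V|].

Section Stuck.
(** [I] stands for the [p] with [a (nx p)] admissible and [J] for the [r] with [b r] admissible.
    Disjointness excludes the move on two blocks, [stuck_up] and [stuck_down] exclude the moves on
    three. *)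
Variables (a : V) (s : seq V) (H : {set V * V}) (I J : {set V}).
Let b := last a s.
Let nx := next (a :: s).
Let pr := prev (a :: s).
Let idx x := index x (a :: s).
Hypothesis S : state (a :: s) H.
Hypothesis aI : a \notin I.
Hypothesis bI : b \notin I.
Hypothesis IJ : [disjoint I & J].
Hypothesis badI : forall p, p \in I -> #|badset H p| <= t.
Hypothesis stuck_up : forall p r, p \in I -> r \in J -> (idx p).+1 < idx r ->
  nx r != b -> r != b -> ok H p (nx r) = false.
Hypothesis stuck_down : forall p q, p \in I -> nx q \in J -> (idx q).+1 < idx p ->
  q != a -> ok H p q = false.
(** The sum of [t + 40] for the bad set of an end, [2 * D + 2] from [deg_ok], and 6 excluded
    vertices. *)
Let e := t + 2 * D + 48.
Hypothesis cJ : #|V| <= 2 * #|J| + 2 * e.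
Hypothesis cI : #|V| <= 2 * #|I| + 2 * (e + 6) + 4 * t.

Let U : uniq (a :: s). Proof. by case: S. Qed.
Let nxK x : pr (nx x) = x. Proof. exact: prev_next. Qed.
Let prK x : nx (pr x) = x. Proof. exact: next_prev. Qed.
Let nxb : nx b = a. Proof. exact: next_last. Qed.

Let idx_nx x : x != b -> idx (nx x) = (idx x).+1.
Proof. by move=> xb; apply: index_next => //; case: S => _ ->. Qed.

Let idx_pr x : x != a -> idx x = (idx (pr x)).+1.
Proof.
move=> xa; rewrite -{1}[x]prK idx_nx //.
by apply: contra_neq xa => E; rewrite -[x]prK E nxb.
Qed.

Let idx_inj x y : idx x = idx y -> x = y.
Proof.
case: S => _ A _ _ E; rewrite -[x](nth_index a (A x)) -[y](nth_index a (A y)).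
by congr nth.
Qed.

Let K := ~: J.
(** [g] bounds the inadmissible neighbours of a good vertex. [h] bounds the excess of [K], at most
    [n/2 + e], over [N p], at least [n/2 - g - 5]. *)
Let g := t + 2 * D + 2.
Let h := e + g + 5.

(** The five removed vertices are the degenerate positions where a three-block move breaks down. *)
Let N p := [set q | ok H p q] :\: [set nx p; nx (nx p); pr p; a; b].

Let N_up p q : p \in I -> q \in N p -> idx p < idx q -> pr q \in K.
Proof.
move=> pI; rewrite !inE !negb_or => /andP[/andP[/andP[/andP[/andP[q1 q2] q3] qa] qb] pq] lt.
apply/negP=> rJ; have pb : p != b by apply: contraNneq bI => <-.
have i1 := idx_pr qa; have i2 := idx_nx pb.
have rb : pr q != b by apply: contra_neq qa => E; rewrite -[q]prK E nxb.
have n1 : idx p != idx (pr q).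
  by apply: contra_neq q1 => /idx_inj->; rewrite prK.
have n2 : idx (nx p) != idx (pr q).
  by apply: contra_neq q2 => /idx_inj->; rewrite prK.
have lt2 : (idx p).+1 < idx (pr q) by move: i1 i2 lt n1 n2; clear; lia.
by have := stuck_up pI rJ lt2; rewrite prK qb rb pq => /(_ isT isT).
Qed.

Let N_down p q : p \in I -> q \in N p -> idx q < idx p -> nx q \in K.
Proof.
move=> pI; rewrite !inE !negb_or => /andP[/andP[/andP[/andP[/andP[_ _] q3] qa] qb] pq] lt.
apply/negP=> rJ; have i2 := idx_nx qb.
have n1 : idx (nx q) != idx p.
  by apply: contra_neq q3 => /idx_inj<-; rewrite nxK.
have lt2 : (idx q).+1 < idx p by move: i2 lt n1; clear; lia.
by rewrite (stuck_down pI rJ lt2 qa) in pq.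
Qed.

Let E p := K :\: (pr @: [set q in N p | idx p < idx q] :|:
                  nx @: [set q in N p | idx q < idx p]).

Let card_N p : p \in I -> #|V| <= 2 * #|N p| + 2 * (g + 5).
Proof.
move=> pI; have := deg_ok p S; have := badI pI; have := adj_deg p.
have := cardsID [set nx p; nx (nx p); pr p; a; b] [set q | ok H p q].
rewrite -/(N p); set M := _ :&: _; have : #|M| <= 5.
  apply: leq_trans (subset_leq_card (subsetIr _ _)) _.
  apply: leq_trans (card_setU_le _ _) _; rewrite cards1 -[5]/(4 + 1) leq_add2r.
  apply: leq_trans (card_setU_le _ _) _; rewrite cards1 -[4]/(3 + 1) leq_add2r.
  apply: leq_trans (card_setU_le _ _) _; rewrite cards1 -[3]/(2 + 1) leq_add2r.
  by rewrite cards2; case: (_ != _).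
by rewrite /g; lia.
Qed.

(** Later neighbours shifted back and earlier neighbours shifted forward fill disjoint parts of [K],
    without collisions. As [K] has hardly more than half of the vertices and [N p] nearly half,
    little of [K] is missed. *)
Let card_E p : p \in I -> #|E p| <= h.
Proof.
move=> pI; set N1 := [set q in N p | idx p < idx q].
set N2 := [set q in N p | idx q < idx p].
have sub : pr @: N1 :|: nx @: N2 \subset K.
  apply/subsetP=> x /setUP[] /imsetP[q]; rewrite [q \in _]inE => /andP[qN lt] ->.
    exact: N_up lt.
  exact: N_down lt.
have N12 : N1 :|: N2 = N p.
  apply/setP=> q; rewrite in_setU [q \in N1]in_set [q \in N2]in_set -andb_orr.
  case qN: (q \in N p) => //=.
  rewrite -neq_ltn; apply: contraTneq qN => /idx_inj->.
  by rewrite !inE /ok adj0 andbF.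
have dis : [disjoint pr @: N1 & nx @: N2].
  rewrite -setI_eq0; apply/eqP/setP=> x; rewrite !inE; apply/negP=> /andP[].
  case/imsetP=> q; rewrite !inE !negb_or -andbA.
  case/andP=> /andP[/andP[/andP[/andP[q1 q2] _] qa] _] /andP[_ lt1] ->.
  case/imsetP=> u; rewrite !inE !negb_or -andbA.
  case/andP=> /andP[/andP[/andP[_ u3] _] ub] /andP[_ lt2] Eqr.
  have := idx_pr qa; rewrite Eqr idx_nx // => iq.
  have n3 : idx (nx u) != idx p by apply: contra_neq u3 => /idx_inj<-; rewrite nxK.
  by move: n3; rewrite (idx_nx ub); move: lt1 lt2 iq; clear; lia.
have : #|pr @: N1 :|: nx @: N2| = #|N p|.
  rewrite cardsU (eqP (_ : _ :&: _ == set0)) ?setI_eq0 // cards0 subn0.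
  rewrite !card_imset; try exact: can_inj prK; try exact: can_inj nxK.
  rewrite -N12 cardsU [N1 :&: N2](_ : _ = set0) ?cards0 ?subn0 //.
  by apply/setP=> q; rewrite !in_set; case: ltngtP; rewrite ?andbF.
rewrite /E cardsD (setIidPr sub) => ->.
have := card_N pI; have := cardsC J; rewrite -/K; move: cJ; rewrite /h.
clear; lia.
Qed.

Let NP p q : q \in N p -> [/\ q != a, q != b & ok H p q].
Proof. by rewrite !inE !negb_or => /andP[/andP[/andP[_ ->] ->] ->]. Qed.

(** Outside the exceptional set the shift can be undone: membership in [K] forces an admissible pair
    at [p]. *)
Let E_up p r : r \in K -> r \notin E p -> idx p < idx r -> ok H p (nx r).
Proof.
move=> rK; rewrite [_ \in E p]in_setD rK andbT negbK => /setUP[] /imsetP[q];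
  rewrite [q \in _]in_set => /andP[/NP[qa qb pq] lt] -> lt2; first by rewrite prK.
by move: lt lt2; rewrite idx_nx //; clear; lia.
Qed.

Let E_down p r : r \in K -> r \notin E p -> idx r < idx p -> ok H p (pr r).
Proof.
move=> rK; rewrite [_ \in E p]in_setD rK andbT negbK => /setUP[] /imsetP[q];
  rewrite [q \in _]in_set => /andP[/NP[qa qb pq] lt] -> lt2; last by rewrite nxK.
by move: lt lt2; rewrite (idx_pr qa); clear; lia.
Qed.

Let notK x : (x \notin K) = (x \in J). Proof. by rewrite inE negbK. Qed.

Let card2_le (x y : V) : #|[set x; y]| <= 2.
Proof. by rewrite cards2; case: (_ != _). Qed.

(** Outside few exceptions, [E_down] at [q] would make [q p] admissible, while [stuck_up] with
    [r = pr q] forbids it. *)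
Let below q : q \in I -> pr q \in J ->
  #|[set p in I | (nx p \in K) && (idx p < idx q)]| <= h + 2.
Proof.
move=> qI qJ; apply: (@leq_trans #|pr @: E q :|: [set pr q; pr (pr q)]|); last first.
  rewrite (leq_trans (card_setU_le _ _)) // leq_add ?card2_le //.
  exact: leq_trans (leq_imset_card _ _) (card_E qI).
apply/subset_leq_card/subsetP=> p; rewrite inE => /and3P[pI pK lt].
rewrite in_setU; case: (boolP (nx p \in E q)) => [pE|pE].
  by apply/orP; left; apply/imsetP; exists (nx p); rewrite ?nxK.
apply/orP; right; rewrite !inE.
have pb : p != b by apply: contraNneq bI => <-.
have qa : q != a by apply: contraNneq aI => <-.
have qb : q != b by apply: contraNneq bI => <-.
have i1 := idx_nx pb; have i2 := idx_pr qa.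
case: (eqVneq p (pr q)) => //= n1; apply/negPn/negP=> n2.
have n1' : idx (nx p) != idx q.
  by apply: contra_neq n1 => /idx_inj<-; rewrite nxK.
have := E_down pK pE; rewrite nxK (ok_sym _ _ S) => /(_ _)/negP.
have n2' : idx (nx p) != idx (pr q).
  by apply: contra_neq n2 => /idx_inj<-; rewrite nxK.
have -> : ok H p q = false.
  rewrite -[q in ok _ _ q]prK; apply: stuck_up => //; rewrite ?prK //.
    by move: i1 i2 n1' n2' lt; clear; lia.
  by apply: contra_neq qa => E1; rewrite -[q]prK E1 nxb.
by apply=> //; move: i1 lt n1'; clear; lia.
Qed.

(** Mirror image of [below]: [E_up] at [p] against [stuck_down] at [q]. *)
Let above p : p \in I -> nx p \in J ->
  #|[set q in I | (pr q \in K) && (idx p < idx q)]| <= h + 2.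
Proof.
move=> pI pJ; apply: (@leq_trans #|nx @: E p :|: [set nx p; nx (nx p)]|); last first.
  rewrite (leq_trans (card_setU_le _ _)) // leq_add ?card2_le //.
  exact: leq_trans (leq_imset_card _ _) (card_E pI).
apply/subset_leq_card/subsetP=> q; rewrite inE => /and3P[qI qK lt].
rewrite in_setU; case: (boolP (pr q \in E p)) => [qE|qE].
  by apply/orP; left; apply/imsetP; exists (pr q); rewrite ?prK.
apply/orP; right; rewrite !inE.
have pb : p != b by apply: contraNneq bI => <-.
have qa : q != a by apply: contraNneq aI => <-.
have pa : p != a by apply: contraNneq aI => <-.
have i1 := idx_nx pb; have i2 := idx_pr qa.
case: (eqVneq q (nx p)) => //= n1; apply/negPn/negP=> n2.
have n1' : idx (pr q) != idx p.
  by apply: contra_neq n1 => /idx_inj<-; rewrite prK.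
have n2' : idx (nx p) != idx (pr q).
  by apply: contra_neq n2 => /idx_inj->; rewrite prK.
have := E_up qK qE; rewrite prK (ok_sym _ _ S) => /(_ _)/negP.
have -> : ok H q p = false.
  by apply: stuck_down => //; move: i1 i2 n1' n2' lt; clear; lia.
by apply=> //; move: i2 lt n1'; clear; lia.
Qed.

Let X p := nx p \in K.
Let Y q := pr q \in K.

(** The elements of [I] violating [X] and those violating [Y] are compared by position: either some
    violator of [X] precedes a violator of [Y], or none does. *)
Let dichotomy :
  #|[set p in I | X p]| <= 2 * (h + 2) + 1 \/
  #|[set p in I | ~~ X p]| <= h + 3 /\ #|[set q in I | ~~ Y q]| <= h + 3.
Proof.
pose Xz := [set p in I | ~~ X p]; pose Yz := [set q in I | ~~ Y q].
have XzP p : p \in Xz -> p \in I /\ nx p \in J.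
  by rewrite inE notK => /andP[].
have YzP q : q \in Yz -> q \in I /\ pr q \in J.
  by rewrite inE notK => /andP[].
case: (boolP [exists p in Xz, [exists q in Yz, idx p < idx q]]).
  case/exists_inP=> p /XzP[pI pJ] /exists_inP[q1 q1Y lt1]; left.
  (* After the last violator [q] of [Y], all of [I] satisfies [Y], so [above] bounds it; before [q],
     [below] bounds the elements satisfying [X]. *)
  case: (arg_maxnP idx q1Y) => q qY qmax; have [qI qJ] := YzP _ qY.
  apply: (@leq_trans #|[set p in I | X p && (idx p < idx q)] :|:
     [set q in I | Y q && (idx p < idx q)] :|: [set q]|).
    apply/subset_leq_card/subsetP=> r; rewrite !inE => /andP[rI rX].
    rewrite rI rX /=; case: ltngtP => // [lt|/idx_inj->]; last by rewrite eqxx !orbT.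
    have pr_lt : idx p < idx r.
      by apply: leq_trans lt1 _; apply: leq_trans (qmax _ q1Y) (ltnW lt).
    rewrite pr_lt andbT; case: (boolP (Y r)) => // rY.
    have rYz : r \in Yz by rewrite inE rI rY.
    by have := qmax _ rYz; rewrite /= leqNgt lt.
  have := below qI qJ; have := above pI pJ.
  have := card_setU_le ([set p in I | X p && (idx p < idx q)] :|:
     [set q in I | Y q && (idx p < idx q)]) [set q].
  have := card_setU_le [set p in I | X p && (idx p < idx q)]
     [set q in I | Y q && (idx p < idx q)].
  by rewrite cards1 /X /Y; clear; lia.
rewrite negb_exists_in => /forall_inP noXY; right.
have YX p q : p \in Xz -> q \in Yz -> idx q <= idx p.
  move=> /noXY; rewrite negb_exists_in => /forall_inP/(_ q) + qY => /(_ qY).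
  by rewrite -leqNgt.
rewrite -/Xz -/Yz; split.
- case: (set_0Vmem Xz) => [->|[p1 p1X]]; first by rewrite cards0.
  (* No violator of [Y] comes after the first violator [p] of [X], so [above] bounds the other
     violators of [X]. *)
  case: (arg_minnP idx p1X) => p pX pmin; have [pI pJ] := XzP _ pX.
  apply: (@leq_trans #|[set q in I | Y q && (idx p < idx q)] :|: [set p]|).
    apply/subset_leq_card/subsetP=> r rX; have [rI _] := XzP _ rX.
    rewrite !inE rI /=; have := pmin _ rX; rewrite leq_eqVlt => /orP[/eqP/idx_inj->|lt].
      by rewrite eqxx orbT.
    rewrite lt andbT; case: (boolP (Y r)) => // rY.
    have rYz : r \in Yz by rewrite inE rI rY.
    by have := YX _ _ pX rYz; rewrite leqNgt lt.
  have := above pI pJ; have := card_setU_le [set q in I | Y q && (idx p < idx q)] [set p].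
  by rewrite cards1 /Y; clear; lia.
case: (set_0Vmem Yz) => [->|[q1 q1Y]]; first by rewrite cards0.
case: (arg_maxnP idx q1Y) => q qY qmax; have [qI qJ] := YzP _ qY.
apply: (@leq_trans #|[set p in I | X p && (idx p < idx q)] :|: [set q]|).
  apply/subset_leq_card/subsetP=> r rY; have [rI _] := YzP _ rY.
  rewrite !inE rI /=; have : idx r <= idx q := qmax _ rY.
  rewrite leq_eqVlt; case/orP=> [/eqP/idx_inj->|lt].
    by rewrite eqxx orbT.
  rewrite lt andbT; case: (boolP (X r)) => // rX.
  have rXz : r \in Xz by rewrite inE rI rX.
  by have := YX _ _ rXz qY; rewrite leqNgt lt.
have := below qI qJ; have := card_setU_le [set p in I | X p && (idx p < idx q)] [set q].
by rewrite cards1 /X; clear; lia.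
Qed.

(** Each edge is charged to its later end [q]. An earlier neighbour [p] with [nx p] in [J] is
    inadmissible for [q] by [stuck_down], unless [p = pr q]; the others satisfy [X] and are few. *)
Let sparse_inside : #|[set p in I | X p]| <= 2 * (h + 2) + 1 ->
  e_count adj I I <= 2 * (#|I| * (2 * h + 6 + g)).
Proof.
move=> Xle; pose R q p := [&& p \in I, adj q p & idx p < idx q].
have fib q : q \in I -> #|[set p | R q p]| <= 2 * h + 6 + g.
  move=> qI.
  apply: (@leq_trans #|[set p in I | X p] :|: (nbhd adj q :\: [set p | ok H q p])
     :|: [set pr q]|).
    apply/subset_leq_card/subsetP=> p; rewrite inE => /and3P[pI qp lt].
    rewrite !in_setU in_setD in_set1 [p \in nbhd _ _]in_set qp andbT.
    rewrite [p \in [set p in I | _]]in_set pI [p \in [set p | ok _ _ _]]in_set /=.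
    case: (boolP (X p)) => //=; rewrite notK => pJ.
    case: (eqVneq p (pr q)) => [|n1]; rewrite ?orbT // orbF.
    have pb : p != b by apply: contraNneq bI => <-.
    have pa : p != a by apply: contraNneq aI => <-.
    have n1' : idx (nx p) != idx q.
      by apply: contra_neq n1 => /idx_inj<-; rewrite nxK.
    rewrite (stuck_down qI pJ) //.
    by move: lt n1'; rewrite idx_nx //; clear; lia.
  have := card_not_ok q S; have := badI qI.
  have := card_setU_le [set p in I | X p] (nbhd adj q :\: [set p | ok H q p]).
  have := card_setU_le ([set p in I | X p] :|: (nbhd adj q :\: [set p | ok H q p]))
    [set pr q].
  by rewrite cards1 /g; move: Xle; clear; lia.
have := card_pairs_le fib; set P := [set p | _] => Ple.
apply: (@leq_trans #|P :|: [set (p.2, p.1) | p in P]|).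
  apply/subset_leq_card/subsetP=> -[x y]; rewrite inE /= => /andP[/andP[xI yI] xy].
  rewrite in_setU; case: (ltngtP (idx x) (idx y)) => lt.
  - apply/orP; right; apply/imsetP; exists (y, x) => //.
    by rewrite inE /= /R yI xI adjC xy lt.
  - by rewrite inE /= /R xI yI xy lt.
  by rewrite (idx_inj lt) adj0 in xy.
rewrite (leq_trans (card_setU_le _ _)) // mul2n -addnn leq_add //.
exact: leq_trans (leq_imset_card _ _) Ple.
Qed.

(** Let [y] in [J] belong to [N p] and come after [p]. Its predecessor is in [K]; if it is also in
    [I], it violates [X], its successor being [y]. Before [p] the same holds with successors and
    [Y]. *)
Let sparse_between :
  #|[set p in I | ~~ X p]| <= h + 3 -> #|[set q in I | ~~ Y q]| <= h + 3 ->
  e_count adj I J <= #|I| * (g + 5 + 2 * (#|K :\: I| + h + 3)).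
Proof.
set Xz := [set p in I | ~~ X p]; set Yz := [set q in I | ~~ Y q] => Xle Yle.
pose R p y := (y \in J) && adj p y.
have fib p : p \in I -> #|[set y | R p y]| <= g + 5 + 2 * (#|K :\: I| + h + 3).
  move=> pI; pose M := [set nx p; nx (nx p); pr p; a; b].
  apply: (@leq_trans #|(nbhd adj p :\: [set y | ok H p y]) :|: M
     :|: nx @: ((K :\: I) :|: Xz) :|: pr @: ((K :\: I) :|: Yz)|).
    apply/subset_leq_card/subsetP=> y; rewrite inE => /andP[yJ py].
    rewrite 3!in_setU [_ \in _ :\: _]in_setD [y \in nbhd _ _]in_set py andbT.
    rewrite [y \in [set y | _]]in_set.
    case: (boolP (ok H p y)) => //= pok; case: (boolP (y \in M)) => //= yM.
    have yN : y \in N p by rewrite in_setD yM in_set pok.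
    case: (ltngtP (idx y) (idx p)) => lt.
    - apply/orP; right; apply/imsetP; exists (nx y); last by rewrite nxK.
      have yK := N_down pI yN lt; rewrite in_setU in_setD yK andbT in_set.
      by case: (nx y \in I) => //=; rewrite /Y nxK notK.
    - apply/orP; left; apply/imsetP; exists (pr y); last by rewrite prK.
      have yK := N_up pI yN lt; rewrite in_setU in_setD yK andbT in_set.
      by case: (pr y \in I) => //=; rewrite /X prK notK.
    by rewrite (idx_inj lt) adj0 in py.
  have M5 : #|M| <= 5.
    apply: leq_trans (card_setU_le _ _) _; rewrite cards1 -[5]/(4 + 1) leq_add2r.
    apply: leq_trans (card_setU_le _ _) _; rewrite cards1 -[4]/(3 + 1) leq_add2r.
    apply: leq_trans (card_setU_le _ _) _; rewrite cards1 -[3]/(2 + 1) leq_add2r.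
    exact: card2_le.
  have := card_not_ok p S; have := badI pI.
  have := leq_imset_card nx ((K :\: I) :|: Xz).
  have := leq_imset_card pr ((K :\: I) :|: Yz).
  have := card_setU_le (K :\: I) Xz; have := card_setU_le (K :\: I) Yz.
  have := card_setU_le (nbhd adj p :\: [set y | ok H p y]) M.
  have := card_setU_le ((nbhd adj p :\: [set y | ok H p y]) :|: M)
    (nx @: ((K :\: I) :|: Xz)).
  have := card_setU_le ((nbhd adj p :\: [set y | ok H p y]) :|: M
     :|: nx @: ((K :\: I) :|: Xz)) (pr @: ((K :\: I) :|: Yz)).
  by rewrite /g; move: M5 Xle Yle; clear; lia.
apply: leq_trans (card_pairs_le fib); apply/subset_leq_card/subsetP=> -[x y].
by rewrite !inE /R /= -andbA.
Qed.

Lemma stuck_extremal : extremal.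
Proof.
have IK : I \subset K by rewrite -disjoints_subset.
have cK := cardsC J; have cKI := cardsD K I; rewrite (setIidPr IK) in cKI.
have In := max_card (mem I).
case: dichotomy => [X_le|[X_le Y_le]].
  exists I, I; have le1 := sparse_inside X_le.
  split; rewrite ?(leq_trans cI) //; try by rewrite /e; move: tD t_ge; clear; lia.
  apply: leq_trans le1 _; rewrite mulnCA [leqRHS]mulnC; apply: leq_mul => //.
  by rewrite /h /g /e; move: tD t_ge; clear; lia.
exists I, J; have le1 := sparse_between X_le Y_le; split.
- by apply: leq_trans cI _; rewrite /e; move: tD t_ge; clear; lia.
- by apply: leq_trans cJ _; rewrite /e; move: tD t_ge; clear; lia.
apply: leq_trans le1 _; rewrite [leqRHS]mulnC; apply: leq_mul => //.
(* [K :\: I] is small because [I] and [J] are disjoint and each has nearly half of the vertices. *)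
rewrite cKI; move: cK cI cJ; rewrite -/K /h /g /e; move: tD t_ge.
clear; lia.
Qed.

End Stuck.

(** * Closing moves on a virtual pair *)

(** A gain of one edge is 2 ordered pairs; at most three new edges enlarge a bad set by at most
    6. *)
Definition closable Z s H : Prop := exists s' H',
  [/\ state s' H', #|H| + 2 <= #|H'|,
      forall c d, c \in Z -> d \in Z -> virt s H c d -> virt s' H' c d
    & forall x, #|badset H' x| <= #|badset H x| + 6].

(** Breaking the virtual pair [b a] is free, and [l] has one pair more than the rest of the broken
    list. *)
Lemma closable_rewire Z s H s' b a l e : state s H -> (b, a) \notin H ->
  size l = (size e).+1 -> size l <= 3 -> perm_eq s' s -> uniq (ends l) ->
  (forall x y, (x, y) \in l -> ok H x y && cyc s' x y) ->
  (forall x y, cyc s x y -> cyc s' x y || ((x, y) \in edges ((b, a) :: e))) ->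
  (forall x y, (x, y) \in l ++ (b, a) :: e -> (x \notin Z) || (y \notin Z)) ->
  closable Z s H.
Proof.
move=> S ba le l3 ps Ul okl brk offZ.
have [H' [S' cH sub keep]] := rewire S ps Ul okl brk offZ.
exists s', H'; split=> //.
  move: cH; rewrite /= (negPf ba) add0n le => cH.
  have := leq_trans cH (leq_add (leqnn _) (leq_mul (leqnn 2) (count_size (mem H) e))).
  by rewrite mulnS addnA leq_add2r.
move=> x; apply: leq_trans (badset_edges x sub) _; rewrite leq_add2l.
by move: l3; clear; lia.
Qed.

Section Closing.
Variables (Z : {set V}) (a : V) (s : seq V) (H : {set V * V}).
Let b := last a s.
Let nx := next (a :: s).
Let idx x := index x (a :: s).
Hypothesis S : state (a :: s) H.
Hypothesis ba : (b, a) \notin H.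
Hypothesis aZ : a \notin Z.

Let U : uniq (a :: s). Proof. by case: S. Qed.
Let mem_s x : x \in a :: s. Proof. by case: S => _ ->. Qed.

Let idx_nx x : x != b -> idx (nx x) = (idx x).+1.
Proof. by move=> xb; apply: index_next => //; case: S => _ ->. Qed.

Let idxa : idx a = 0. Proof. by rewrite /idx /= eqxx. Qed.

Let idxb x : idx x <= idx b.
Proof. by rewrite /idx /b index_last // -ltnS index_mem mem_s. Qed.

Let idx_lt_b x : x != b -> idx x < idx b.
Proof.
move=> xb; rewrite ltn_neqAle idxb andbT; apply: contra_neq xb => E.
by rewrite -[x](nth_index a (mem_s x)) -/(idx x) E nth_index.
Qed.

Let neq_b x y : idx x < idx y -> x != b.
Proof. by apply: contraTneq => ->; rewrite -leqNgt idxb. Qed.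

Let idx_gt0 x : x != a -> 0 < idx x.
Proof. by rewrite /idx /= eq_sym => /negPf->. Qed.

(* P ++ Q becomes rev P ++ Q. *)
Lemma close_two x : x != b -> x != a -> nx x != b -> x \notin Z ->
  nx x \notin Z -> ok H a (nx x) -> ok H b x -> closable Z (a :: s) H.
Proof.
move=> xb xa nxb xZ nxZ oka okb; have ix := idx_nx xb.
have := next_split U (mem_s x) xb; rewrite -/nx -/b => -[s1 [s2 [Es l1 l2]]].
apply: (@closable_rewire _ _ _ (rev (a :: s1) ++ nx x :: s2) b a
  [:: (a, nx x); (b, x)] [:: (x, nx x)]) => //.
- by rewrite Es -cat_cons perm_cat2r perm_rev.
(* Distinctness of the ends of the new pairs is read off their positions. *)
- apply: (@map_uniq _ _ idx); rewrite /= !inE idxa ix.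
  by move: (idx_lt_b nxb) (idx_gt0 xa); rewrite ix; clear; lia.
- move=> y z; rewrite rev_lastE cyc_cat2 last_rev_belast l1 l2 !inE !xpair_eqE.
  by case/orP=> /andP[/eqP-> /eqP->]; rewrite ?oka ?okb same_pairxx !orbT.
- move=> y z; rewrite Es rev_lastE -cat_cons !cyc_cat2 walk_rev last_rev_belast.
  by rewrite l1 mem_edges /= l2; split_ors; move=> ->; rewrite ?orbT.
move=> y z; rewrite !inE !xpair_eqE.
by split_ors; case/andP=> /eqP-> /eqP->; rewrite ?aZ ?xZ ?nxZ ?orbT.
Qed.

(* P ++ Q ++ R becomes rev Q ++ P ++ R. *)
Lemma close_up p r : p != a -> p \notin Z -> r \notin Z -> r != b -> nx r != b ->
  nx p \notin Z -> (idx p).+1 < idx r ->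
  ok H a (nx p) -> ok H p (nx r) -> ok H b r -> closable Z (a :: s) H.
Proof.
move=> pa pZ rZ rb nrb npZ lt ok1 ok2 ok3.
have pb := neq_b (ltnW lt).
have ip := idx_nx pb; have ir := idx_nx rb.
have := next_split2 U (mem_s r) (ltnW lt) rb.
rewrite -/nx -/b => -[s1 [s2 [s3 [Es l1 l2 l3]]]].
apply: (@closable_rewire _ _ _ (rev (nx p :: s2) ++ (a :: s1) ++ nx r :: s3) b a
  [:: (a, nx p); (p, nx r); (b, r)] [:: (p, nx p); (r, nx r)]) => //.
- by apply/permP=> f; rewrite Es /= !count_cat count_rev /= !count_cat /=; clear; lia.
- apply: (@map_uniq _ _ idx); rewrite /= !inE idxa ip ir.
  by move: (idx_lt_b nrb) (idx_gt0 pa) lt; rewrite ir; clear; lia.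
- move=> y z; rewrite rev_lastE cyc_cat3 last_rev_belast l1 l2 l3 !inE !xpair_eqE.
  by case/or3P=> /andP[/eqP-> /eqP->]; rewrite ?ok1 ?ok2 ?ok3 ?same_pairxx
    1?[same_pair (nx p) a _ _]same_pairC ?same_pairxx !orbT.
- move=> y z; rewrite {1}Es rev_lastE -[a :: _]/((a :: s1) ++ _) !cyc_cat3.
  rewrite walk_rev last_rev_belast.
  by rewrite l1 l2 l3 mem_edges /=; split_ors; move=> ->; rewrite ?orbT.
move=> y z; rewrite !inE !xpair_eqE.
by split_ors; case/andP=> /eqP-> /eqP->; rewrite ?aZ ?pZ ?rZ ?npZ ?orbT.
Qed.

(* P ++ Q ++ R becomes Q ++ rev P ++ R. *)
Lemma close_down p q : q != a -> p \notin Z -> nx q \notin Z ->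
  nx p \notin Z -> nx p != b -> (idx q).+1 < idx p ->
  ok H a (nx p) -> ok H p q -> ok H b (nx q) -> closable Z (a :: s) H.
Proof.
move=> qa pZ nqZ npZ npb lt ok1 ok2 ok3.
have qb := neq_b (ltnW lt).
have pb : p != b by apply: contraTneq ok1 => ->; rewrite /nx /b next_last // /ok adj0.
have ip := idx_nx pb; have iq := idx_nx qb.
have := next_split2 U (mem_s p) (ltnW lt) pb.
rewrite -/nx -/b => -[s1 [s2 [s3 [Es l1 l2 l3]]]].
apply: (@closable_rewire _ _ _ ((nx q :: s2) ++ rev (a :: s1) ++ nx p :: s3) b a
  [:: (a, nx p); (p, q); (b, nx q)] [:: (p, nx p); (q, nx q)]) => //.
- by apply/permP=> f; rewrite Es /= !count_cat count_rev /= !count_cat /=; clear; lia.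
- apply: (@map_uniq _ _ idx); rewrite /= !inE idxa ip iq.
  by move: (idx_lt_b npb) (idx_gt0 qa) lt; rewrite ip; clear; lia.
- move=> y z; rewrite rev_lastE cyc_cat3 last_rev_belast l1 l2 l3 !inE !xpair_eqE.
  by case/or3P=> /andP[/eqP-> /eqP->]; rewrite ?ok1 ?ok2 ?ok3 ?same_pairxx !orbT.
- move=> y z; rewrite {1}Es rev_lastE -[a :: _]/((a :: s1) ++ _) !cyc_cat3.
  rewrite walk_rev last_rev_belast.
  by rewrite l1 l2 l3 mem_edges /=; split_ors; move=> ->; rewrite ?orbT.
move=> y z; rewrite !inE !xpair_eqE.
by split_ors; case/andP=> /eqP-> /eqP->; rewrite ?aZ ?pZ ?nqZ ?npZ ?orbT.
Qed.

End Closing.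

(** If the state is not closable, each of the three moves is blocked, which gives the hypotheses of
    [stuck_extremal] for the sets [I] and [J] below. Both avoid [Z] and the ends, so that the moves
    respect the protected pairs. *)
Lemma close_pair Z a s H : state (a :: s) H -> (last a s, a) \notin H ->
  #|Z| <= 4 -> a \notin Z -> last a s \notin Z ->
  #|badset H a| <= t + 40 -> #|badset H (last a s)| <= t + 40 ->
  extremal \/ closable Z (a :: s) H.
Proof.
move=> S; set b := last a s => ba Z4 aZ bZ a_bad b_bad.
have [C|nC] := EM (closable Z (a :: s) H); [by right|left].
have [U A _ _] := S; pose X := Z :|: [set a; b].
have X_le : #|X| <= 6.
  have := card_setU_le Z [set a; b]; rewrite cards2 -/X; move: Z4.
  by case: (a != b); clear; lia.
(* Removing the at most [2 * t] bad vertices accounts for the term [4 * t] in the bound on [I]. *)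
pose I := [set x | [&& ok H a (next (a :: s) x), x \notin X & next (a :: s) x \notin X]]
  :\: bad t H.
pose J := [set x | ok H b x & x \notin X].
have XP x : x \notin X -> [/\ x \notin Z, x != a & x != b].
  by rewrite !inE !negb_or => /and3P[].
have IP p : p \in I -> [/\ ok H a (next (a :: s) p), p \notin X,
    next (a :: s) p \notin X & #|badset H p| <= t].
  by rewrite !in_setD !in_set -leqNgt => /andP[-> /and3P[]].
have JP r : r \in J -> ok H b r /\ r \notin X by rewrite in_set => /andP[].
apply: (@stuck_extremal a s H I J S).
- by apply/negP=> /IP[_ /XP[_]]; rewrite eqxx.
- by apply/negP=> /IP[_ /XP[_ _]]; rewrite eqxx.
- rewrite -setI_eq0; apply/eqP/setP=> x; rewrite in_set0; apply/negP=> /setIP[].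
  case/IP=> okx /XP[xZ xa xb] /XP[nxZ _ nxb] _ /JP[okb _]; apply: nC.
  exact: (close_two S ba aZ xb xa nxb).
- by move=> p /IP[].
- move=> p r /IP[okx /XP[pZ pa pb] /XP[npZ _ npb] _] /JP[okb /XP[rZ ra rb]] lt nrb _.
  apply/negP=> okp; apply: nC.
  exact: (close_up S ba aZ pa pZ rZ).
- move=> p q /IP[okx /XP[pZ pa pb] /XP[npZ _ npb] _] /JP[okb /XP[rZ ra rb]] lt qa.
  apply/negP=> okp; apply: nC.
  exact: (close_down S ba aZ qa pZ rZ).
- have := deg_ok b S; have := adj_deg b; have := card_setU_le J X.
  have : #|[set y | ok H b y]| <= #|J :|: X|.
    apply/subset_leq_card/subsetP=> y; rewrite in_setU [y \in J]in_set in_set => ->.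
    by case: (y \in X).
  by move: X_le b_bad; clear; lia.
have := deg_ok a S; have := adj_deg a; have := card_bad S Dn.
have := card_setU_le (next (a :: s) @: (I :|: bad t H :|: X)) X.
have := leq_imset_card (next (a :: s)) (I :|: bad t H :|: X).
have := card_setU_le (I :|: bad t H) X; have := card_setU_le I (bad t H).
have : #|[set y | ok H a y]| <= #|(next (a :: s) @: (I :|: bad t H :|: X)) :|: X|.
  apply/subset_leq_card/subsetP=> y; rewrite in_set => oky.
  rewrite in_setU; case: (boolP (y \in X)) => yX; rewrite ?orbT // orbF.
  apply/imsetP; exists (prev (a :: s) y); last by rewrite next_prev.
  rewrite in_setU in_setU in_setD [X in ~~ _ && X]in_set next_prev // oky yX andbT /=.
  by case: (_ \in bad t H); case: (_ \in X).
by move: X_le a_bad; clear; lia.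
Qed.

(** * One augmentation step *)

Lemma cut_state s H c d : state s H -> virt s H c d ->
  exists s', [/\ state (d :: s') H, last d s' = c
    & forall x y, virt s H x y -> virt (d :: s') H x y].
Proof.
move=> S /andP[cd _]; have [s' [p l c']] := cyc_cut cd.
exists s'; split=> //; first exact: state_eq_cyc p c'.
by move=> x y /andP[xy n]; rewrite /virt c' xy n.
Qed.

Lemma virt_sym s H c d : state s H -> virt s H c d = virt s H d c.
Proof. by move=> S; rewrite /virt cyc_sym (state_sym c d S). Qed.

(** Replacing both ends loses at most 2 ordered pairs each and leaves three virtual pairs with good
    ends. Closing all three gains 2 each, a net gain of 2. The bad sets of these ends stay below
    [t + 16], within the allowance [t + 40]. *)
Lemma augment s H c d : state s H -> virt s H c d ->
  extremal \/ exists s' H', state s' H' /\ #|H| < #|H'|.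
Proof.
move=> S cd; have [s0 [S0 l0 _]] := cut_state S cd.
have n0 : (last d s0, d) \notin H by rewrite l0; case/andP: cd.
have [||y [s1 [c1 [d1 [H1 [[S1 l1 n1 v1 H1_ge] [_ bad1 P1 /andP[yc1 yd1]]]]]]]] :=
  @fix_end set0 _ _ _ S0 n0; rewrite ?cards0 ?inE //.
have [|by1 _ yb] := and3P (P1 y _); first by rewrite !inE eqxx !orbT.
have [|bc1 _ c1b] := and3P (P1 c1 _); first by rewrite !inE eqxx.
have [|bd1 _ d1b] := and3P (P1 d1 _); first by rewrite !inE eqxx !orbT.
set b := last d s0 in l1 n1 yb c1b d1b.
(* The order is turned round so that [b] is the head and can be replaced in its turn. *)
have vyb : virt (y :: s1) H1 y b.
  by rewrite (virt_sym _ _ S1) /virt n1 -l1 cyc_ends.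
have [s1' [S1' l1' V1]] := cut_state S1 vyb.
have [||| y2 [s2 [c2 [d2 [H2 [[S2 l2 n2 v2 H2_ge] [Z2 bad2 P2 /andP[yc2 yd2]]]]]]]] :=
  @fix_end [set c1; d1] _ _ _ S1'; rewrite ?l1' ?cards2 ?inE ?negb_or ?yc1 //.
- by case/andP: vyb.
- by case: (_ != _).
have {}P2 w : w \in [:: c2; d2; y2] ->
    [/\ #|badset H2 w| <= t + 4, w != c1, w != d1 & w != y].
  by move/P2; rewrite !inE negb_or l1' => /and3P[-> /andP[-> ->] ->].
have [|by2 y2c1 y2d1 y2y] := P2 y2; first by rewrite !inE eqxx !orbT.
have [|bc2 c2c1 c2d1 c2y] := P2 c2; first by rewrite !inE eqxx.
have [|bd2 d2c1 d2d1 d2y] := P2 d2; first by rewrite !inE eqxx !orbT.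
rewrite l1' in l2 n2.
have v12 : virt (y2 :: s2) H2 c1 d1.
  by apply: Z2; rewrite ?inE ?eqxx ?orbT //; apply: V1.
have [||||||C|[s3 [H3 [S3 H3_ge Z3 bad3]]]] :=
  @close_pair ([set c1; d1] :|: [set c2; d2]) _ _ _ S2; [..|by left|]; rewrite ?l2 //.
- apply: leq_trans (card_setU_le _ _) _; rewrite !cards2.
  by case: (_ != _); case: (_ != _).
- by rewrite !inE !negb_or y2c1 y2d1 yc2 yd2.
- by rewrite !inE !negb_or yc1 yd1 ![y == _]eq_sym c2y d2y.
- by apply: leq_trans by2 _; rewrite leq_add2l.
- by apply: leq_trans (bad2 y) _; move: by1; clear; lia.
have v13 : virt s3 H3 c1 d1 by apply: Z3; rewrite ?inE ?eqxx ?orbT.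
have v23 : virt s3 H3 c2 d2 by apply: Z3; rewrite ?inE ?eqxx ?orbT.
have [s3' [S3' l3 V3]] := cut_state S3 v13.
have [||||||C|[s4 [H4 [S4 H4_ge Z4 bad4]]]] :=
  @close_pair [set c2; d2] _ _ _ S3'; [..|by left|]; rewrite ?l3 //.
- by case/andP: v13.
- by rewrite cards2; case: (_ != _).
- by rewrite !inE !negb_or ![d1 == _]eq_sym c2d1 d2d1.
- by rewrite !inE !negb_or ![c1 == _]eq_sym c2c1 d2c1.
- by move: (bad2 d1) (bad3 d1) bd1; clear; lia.
- by move: (bad2 c1) (bad3 c1) bc1; clear; lia.
have v24 : virt s4 H4 c2 d2 by apply: Z4; rewrite ?inE ?eqxx ?orbT //; apply: V3.
have [s4' [S4' l4 V4]] := cut_state S4 v24.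
have [||||||C|[s5 [H5 [S5 H5_ge Z5 bad5]]]] :=
  @close_pair set0 _ _ _ S4'; [..|by left|]; rewrite ?l4 ?cards0 ?inE //.
- by case/andP: v24.
- by move: (bad3 d2) (bad4 d2) bd2; clear; lia.
- by move: (bad3 c2) (bad4 c2) bc2; clear; lia.
right; exists s5, H5; split=> //.
by move: H1_ge H2_ge H3_ge H4_ge H5_ge; clear; lia.
Qed.

(** * The case without incompatibilities *)

(** The predecessors of the neighbours of [d] and the neighbours of [b] both miss [b], and their
    numbers add up to at least [#|V|]; so they share a vertex [x], at which the order closes. *)
Lemma augment_Dirac s H c d : (forall v x y, ~~ F v x y) ->
  state s H -> virt s H c d -> exists s' H', state s' H' /\ #|H| < #|H'|.
Proof.
move=> F0 S0 cd; have [s0 [S l0 _]] := cut_state S0 cd.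
have ba : (last d s0, d) \notin H by rewrite l0; case/andP: cd.
suff [s' [H' [S' lt _ _]]] : closable set0 (d :: s0) H.
  by exists s', H'; split=> //; move: lt; clear; lia.
have [U A _ _] := S; set b := last d s0 in l0 ba.
have nxb : next (d :: s0) b = d by apply: next_last.
have nxI : injective (next (d :: s0)) by apply: can_inj (prev_next U).
have okF x y : adj x y -> (x, y) \notin H -> ok H x y.
  by move=> xy n; apply/okP; split.
have close_ends : adj b d -> closable set0 (d :: s0) H.
  move=> bd; apply: (@closable_rewire _ _ _ (d :: s0) b d [:: (b, d)] [::]) => //.
  - by rewrite /= inE andbT; apply: contraTneq bd => ->; rewrite adj0.
  - move=> x y; rewrite inE => /eqP[-> ->]; by rewrite cyc_ends okF.
  - by move=> x y xy; apply/orP; left.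
  - by move=> x y _; rewrite inE.
pose M := [set x | adj d (next (d :: s0) x)].
pose N := nbhd adj b.
have Mdeg : #|M| = deg adj d.
  rewrite /deg -(card_imset _ nxI); apply/eq_card=> y; rewrite [RHS]in_set.
  apply/imsetP/idP=> [[x]|dy]; first by rewrite in_set => ? ->.
  by exists (prev (d :: s0) y); rewrite ?in_set next_prev.
have : M :&: N != set0.
  apply: contraTneq (adj_deg d) => MN0; rewrite -ltnNge.
  have : #|M :|: N| <= #|[set~ b]|.
    apply/subset_leq_card/subsetP=> x; rewrite in_setU ![x \in _]in_set in_set1.
    apply: contraTneq => ->.
    by rewrite nxb !adj0.
  have := cardsC1 b; have := adj_deg b.
  rewrite cardsU MN0 cards0 subn0 Mdeg -[#|N|]/(deg adj b).
  have : 0 < #|V| by apply/card_gt0P; exists b.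
  by have := adj_deg d; clear; lia.
case/set0Pn=> x; rewrite !inE => /andP[dx bx].
have xb : x != b by apply: contraTneq bx => ->; rewrite adj0.
(* In the two degenerate positions, [x = d] and [next x = b], the pair [b d] is itself an edge. *)
case: (eqVneq x d) => [xd|xd]; first by apply: close_ends; rewrite -xd.
case: (eqVneq (next (d :: s0) x) b) => [xE|nxb'].
  by apply: close_ends; rewrite adjC -xE.
apply: (close_two S ba _ xb xd nxb'); rewrite ?inE //; apply: okF => //.
  apply/negP=> /(state_cyc S)/(cyc_next U)[/nxI E|E]; first by rewrite E eqxx in xd.
  by rewrite -(nxI _ _ (etrans nxb E)) eqxx in nxb'.
apply/negP=> /(state_cyc S)/(cyc_next U)[E|E]; first by rewrite E nxb eqxx in xd.
by rewrite -E eqxx in nxb'.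
Qed.

(** * From full states to compatible Hamilton cycles *)

Lemma cycle_edge_cyc s x y : cycle_edge s x y -> cyc s x y.
Proof.
case/hasP=> i; rewrite mem_iota add0n => /andP[_ lt].
move=> xy; have := cyc_nth x lt; case/orP: xy => /andP[/eqP-> /eqP->] //.
by rewrite cyc_sym.
Qed.

Lemma hamilton_of_full_state s H : state s H ->
  (forall x y, cyc s x y -> (x, y) \in H) -> 2 < #|V| ->
  hamilton_cycle adj s /\ compatible_cycle F s.
Proof.
move=> S full V3; have [U A Hs C] := S; split; last first.
  move=> v x y /cycle_edge_cyc/full vx /cycle_edge_cyc/full vy _; exact: C vx vy.
have sV : size s = #|V| by rewrite -(card_uniqP U); apply: eq_card.
split; rewrite ?sV //; apply: cyc_cycle => x y /full xy.
by have /and3P[] := Hs _ _ xy.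
Qed.

(** Induction on the number of ordered pairs outside [H], from the empty [H]. [P] is an escape from
    the augmentation: [extremal], or [False] in the Dirac case. *)
Lemma hamilton_or (P : Prop) : 2 < #|V| ->
  (forall s H c d, state s H -> virt s H c d ->
     P \/ exists s' H', state s' H' /\ #|H| < #|H'|) ->
  P \/ exists s, hamilton_cycle adj s /\ compatible_cycle F s.
Proof.
move=> V3 step.
suff key n s H : state s H -> #|{: V * V}| - #|H| <= n ->
    P \/ exists s, hamilton_cycle adj s /\ compatible_cycle F s.
  apply: (key _ (enum V) set0 _ (leqnn _)); split; rewrite ?enum_uniq //.
  - by move=> x; rewrite mem_enum.
  - by move=> x y; rewrite inE.
  by move=> v x y; rewrite inE.
elim: n s H => [|n IH] s H S le.
all: have [[x [y xy]]|full] := EM (exists x y, virt s H x y); last first.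
all: try by right; exists s; apply: (hamilton_of_full_state S) => // x y xy;
  apply/negPn/negP=> n_xy; case: full; exists x, y; rewrite /virt xy.
all: have [|[s' [H' [S' lt]]]] := step _ _ _ _ S xy; first by left.
all: have mx : #|H'| <= #|{: V * V}| := max_card _.
  by move: le lt mx; clear; lia.
by apply: IH S' _; move: le lt mx; clear; lia.
Qed.

End States.

(** * Choice of the integer parameters and conclusion *)

Local Open Scope ring_scope.

Theorem theorem3p1 (R : realType) (mu : R) (V : finType) (adj : rel V)
    (F : V -> rel V) :
  0 < mu -> Num.sqrt mu < 1 / 400 ->
  simple_graph adj ->
  (forall v : V, (#|V|)%:R / 2 <= (deg adj v)%:R :> R) ->
  incompat_system adj F ->
  bounded adj F (mu * (#|V|)%:R) ->
  (exists s : seq V, hamilton_cycle adj s /\ compatible_cycle F s)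
  \/
  (exists A B : {set V},
      [/\ (1 / 2 - 200 * Num.sqrt mu) * (#|V|)%:R <= (#|A|)%:R,
          (1 / 2 - 200 * Num.sqrt mu) * (#|V|)%:R <= (#|B|)%:R
        & (e_count adj A B)%:R <= 16 * Num.sqrt mu * ((#|V|)%:R ^+ 2)]).
Proof.
move=> mu0; set r := Num.sqrt mu => r_lt [adjC adj0] degR Fsys bnd.
have r0 : 0 < r by rewrite sqrtr_gt0.
have r2 : mu = r ^+ 2 by rewrite sqr_sqrtr ?ltW.
have adj_deg v : (#|V| <= 2 * deg adj v)%N.
  have := degR v; rewrite ler_pdivrMr // -natrM ler_nat mulnC //.
have FD v x : (#|[set y | F v x y]|)%:R <= mu * (#|V|)%:R.
  case: (boolP (adj v x)) => [|nvx]; first exact: bnd.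
  have -> : [set y | F v x y] = set0.
    by apply/setP=> y; rewrite !inE; apply: contraNF nvx => /Fsys[].
  by rewrite cards0 mulr_ge0 // ltW.
(* With at most two vertices, a singleton (or the empty set, if there is no vertex) serves as both
   sets: it has at least half of the vertices and spans no edge. *)
have [V3|V2] := ltnP 2 #|V|; last first.
  right; pose A := if [pick v : V] is Some v then [set v] else set0.
  have A_ge : (1 / 2 - 200 * r) * (#|V|)%:R <= (#|A|)%:R.
    rewrite /A; case: pickP => [v _|V0]; last by rewrite (eq_card0 V0) mulr0 cards0.
    rewrite cards1; have : (#|V|)%:R <= 2 :> R by rewrite (ler_nat _ _ 2).
    have : 0 <= (#|V|)%:R :> R by []; nra.
  exists A, A; split=> //; rewrite (_ : e_count adj A A = 0%N).
    by rewrite !mulr_ge0 ?exprn_ge0 // ltW.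
  rewrite /e_count; apply/eqP; rewrite cards_eq0; apply/eqP/setP=> -[x y]; rewrite !inE /=.
  rewrite /A; case: pickP => [v _|V0]; last by rewrite !inE.
  by rewrite !inE; apply/negP=> /andP[/andP[/eqP-> /eqP->]]; rewrite adj0.
(* An integer below 1 is 0, so in the first case there is no incompatibility at all. *)
have [small|large] := ltP (mu * (#|V|)%:R) 1.
  left; have F0 v x y : ~~ F v x y.
    apply/negP=> f; have := le_lt_trans (FD v x) small.
    by rewrite (ltr_nat _ _ 1) ltnS leqn0 cards_eq0 => /eqP/setP/(_ y); rewrite !inE f.
  have [s H c d S cd|[]|//] := @hamilton_or V adj F False V3; right.
  exact: (augment_Dirac adjC Fsys adj_deg adj0 F0 S cd).
(* Rounding [r * N] up and [mu * N] down gives [D * N <= mu * N^2 = (r * N)^2 <= t^2]. *)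
pose N : R := (#|V|)%:R; pose t := (Num.truncn (r * N)).+1.
pose D := Num.truncn (mu * N); rewrite -/N in FD large *.
have N0 : 0 <= N by rewrite ler0n.
have rN0 : 0 <= r * N by rewrite mulr_ge0 // ltW.
have muN0 : 0 <= mu * N by rewrite mulr_ge0 // ltW.
have /andP[t_le t_gt] := truncn_itv rN0; rewrite -/t in t_gt.
have /andP[D_le _] := truncn_itv muN0; rewrite -/D in D_le.
have t_le1 : t%:R <= r * N + 1 by rewrite /t -natr1 lerD2r.
(* From [1 <= mu * N = r * (r * N)] and [r < 1/400]. *)
have rN_ge : 400 < r * N.
  have : 1 <= r * (r * N) by rewrite mulrA -expr2 -r2.
  by nra.
have FDn v x : (#|[set y | F v x y]| <= D)%N by rewrite truncn_ge_nat.
have DV : (D * #|V| <= t ^ 2)%N.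
  rewrite -(ler_nat R) natrM natrX; apply: (@le_trans _ _ ((r * N) ^+ 2)).
    by rewrite exprMn -r2 expr2 mulrA ler_wpM2r.
  by rewrite lerXn2r ?nnegrE ?ler0n // ltW.
have tD : (100 * D <= t)%N.
  rewrite -(ler_nat R) natrM; move: D_le t_gt; rewrite r2 => D_le t_gt.
  have : r ^+ 2 * N <= 1 / 400 * (r * N) by rewrite expr2 -mulrA ler_wpM2r // ltW.
  by lra.
have t_ge : (400 <= t)%N by rewrite -(ler_nat R); lra.
have tV : (100 * t <= #|V|)%N.
  rewrite -(ler_nat R) natrM -/N.
  have : r * N <= 1 / 400 * N by rewrite ler_wpM2r // ltW.
  by lra.
have [|[A [B [cA cB eAB]]]|] := @hamilton_or V adj F (extremal adj t) V3; last by left.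
  move=> s H c d S cd.
  exact: (augment adjC Fsys FDn DV tD t_ge tV adj_deg adj0 S cd).
have sizeR (C : {set V}) : (#|V| <= 2 * #|C| + 40 * t)%N ->
    (1 / 2 - 200 * r) * N <= (#|C|)%:R.
  by rewrite -(ler_nat R) natrD !natrM -/N => cC; lra.
right; exists A, B; split; [exact: sizeR|exact: sizeR|].
(* [15 * t] is at most [15 * r * N + 15], which is below [16 * r * N] since [r * N > 400]. *)
move: eAB; rewrite -(ler_nat R) !natrM -/N => /le_trans; apply.
by rewrite expr2 !mulrA ler_wpM2r //; lra.
Qed.
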